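(* Let $m$ be a positive integer and let $(K,\partial_0,\dots,\partial_{m-1})$ be a field with $m$ commuting derivations. Let $\mu\in\mathbb{N}^m$ and let $n$ be a positive integer, and suppose $K$ has a field extension $K(a_h^{\xi}\colon|\xi|\le|\mu|\land h<n)$ that meets the differential condition, and such that $\sigma\le\mu$ whenever $a_k^{\sigma}$ is a minimal separable leader. Then $(K,\partial_0,\dots,\partial_{m-1})$ has an extension $(M,D_0,\dots,D_{m-1})$ (a field $M\supseteq K$ with $m$ commuting derivations extending the $\partial_i$) compatible with $K(a_h^{\xi}\colon|\xi|<|\mu|\land h<n)$, i.e. $K(a_h^{\xi}\colon|\xi|<|\mu|\land h<n)\subseteq M$ and $D_ia_k^{\sigma}=a_k^{\sigma+\varepsilon_i}$ whenever $i<m$, $k<n$ and $|\sigma|+1<|\mu|$.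
   Context: $n$ denotes also $\{0,\dots,n-1\}$. For $\sigma\in\mathbb{N}^m$, $|\sigma|=\sum_{i<m}\sigma(i)$; $\le$ is the componentwise order on $\mathbb{N}^m$; $\varepsilon_i$ is the characteristic function of $\{i\}$ in $\mathbb{N}^m$. The total order $\unlhd$ on $\mathbb{N}^m\times n$: $(\xi,k)\unlhd(\eta,g)$ iff $(|\xi|,k,\xi(0),\dots,\xi(m-2))$ is lexicographically $\le(|\eta|,g,\eta(0),\dots,\eta(m-2))$; $\lhd$ is the strict version. The extension meets the differential condition if: whenever $i<m$, $k<n$, $|\sigma|+1\le|\mu|$, and $f$ is a polynomial over $K$ in variables $(x_h^{\xi}\colon(\xi,h)\unlhd(\sigma,k))$ vanishing at $a=(a_h^{\xi}\colon(\xi,h)\unlhd(\sigma,k))$, then $\sum_{(\eta,g)\unlhd(\sigma,k)}\frac{\partial f}{\partial x_g^{\eta}}(a)\,a_g^{\eta+\varepsilon_i}+f^{\partial_i}(a)=0$, with $f^{\partial_i}$ being $f$ with $\partial_i$ applied to its coefficients. A generator $a_k^{\sigma}$ is a separable leader if it is separably algebraic over $K(a_h^{\xi}\colon(\xi,h)\lhd(\sigma,k))$, and a minimal separable leader if in addition no $a_k^{\rho}$ with $\rho\le\sigma$, $\rho\ne\sigma$, is a separable leader. *)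

(* Defs.v *)
From HB Require Import structures.
From mathcomp Require Import all_boot all_order all_algebra.
From mathcomp Require Import separable.
From mathcomp Require Import mpoly.
Set Implicit Arguments. Unset Strict Implicit. Unset Printing Implicit Defensive.
Import Order.TTheory GRing.Theory.
Local Open Scope ring_scope.

Definition MI (m : nat) := {ffun 'I_m -> nat}.

Definition msum (m : nat) (xi : MI m) : nat := (\sum_(i < m) xi i)%N.

Definition mle (m : nat) (xi eta : MI m) : bool := [forall i, (xi i <= eta i)%N].

Definition mshift (m : nat) (xi : MI m) (i : 'I_m) : MI m :=
  [ffun j => (xi j + (j == i))%N].

Fixpoint lexle (s t : seq nat) : bool :=
  match s, t with
  | [::], _ => true
  | _ :: _, [::] => false
  | x :: s', y :: t' => (x < y)%N || ((x == y) && lexle s' t')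
  end.

Definition okey (m n : nat) (xi : MI m) (k : 'I_n) : seq nat :=
  msum xi :: (k : nat) :: map (fun i : 'I_m => xi i) (filter (fun i : 'I_m => (i < m.-1)%N) (enum 'I_m)).

Definition ole (m n : nat) (xi : MI m) (k : 'I_n) (eta : MI m) (g : 'I_n) : bool :=
  lexle (okey xi k) (okey eta g).

Definition olt (m n : nat) (xi : MI m) (k : 'I_n) (eta : MI m) (g : 'I_n) : bool :=
  ole xi k eta g && (okey xi k != okey eta g).

Definition is_derivation (R : comRingType) (d : R -> R) : Prop :=
  (forall x y, d (x + y) = d x + d y) /\ (forall x y, d (x * y) = x * d y + d x * y).

Definition commuting_derivations (R : comRingType) (m : nat) (d : 'I_m -> R -> R) : Prop :=
  (forall i, is_derivation (d i)) /\ (forall i j x, d i (d j x) = d j (d i x)).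

Definition subfield_closed (L : fieldType) (S : L -> Prop) : Prop :=
  [/\ S 1, (forall x y, S x -> S y -> S (x - y)), (forall x y, S x -> S y -> S (x * y))
    & (forall x, S x -> S x^-1)].

Definition gen_field (K L : fieldType) (iota : K -> L) (A : L -> Prop) : L -> Prop :=
  fun x => forall S : L -> Prop, subfield_closed S -> (forall c, S (iota c)) ->
           (forall y, A y -> S y) -> S x.

Definition gen_by (K L : fieldType) (iota : K -> L) (m n : nat)
    (a : MI m -> 'I_n -> L) (P : MI m -> 'I_n -> Prop) : L -> Prop :=
  gen_field iota (fun y => exists xi h, P xi h /\ y = a xi h).

Definition separably_algebraic_over (L : fieldType) (E : L -> Prop) (x : L) : Prop :=
  exists p : {poly L}, [/\ p != 0, (forall j, E p`_j), separable_poly p & root p x].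

(* The differential condition for the extension K(a_h^xi : |xi| <= |mu|, h < n).
   A polynomial over K in (finitely many distinct) variables x_h^xi with
   (xi,h) ⊴ (sigma,k) is encoded as f : {mpoly K[N]} together with an injective
   assignment v : 'I_N -> N^m * n of the variables, all ⊴ (sigma,k). *)
Definition differential_condition (K L : fieldType) (iota : {rmorphism K -> L})
    (m : nat) (d : 'I_m -> K -> K) (mu : MI m) (n : nat) (a : MI m -> 'I_n -> L) : Prop :=
  forall (i : 'I_m) (k : 'I_n) (sigma : MI m), (msum sigma + 1 <= msum mu)%N ->
  forall (N : nat) (v : 'I_N -> (MI m * 'I_n)%type) (f : {mpoly K[N]}),
    injective v -> (forall j, ole (v j).1 (v j).2 sigma k) ->
    (map_mpoly iota f).@[fun j => a (v j).1 (v j).2] = 0 ->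
    \sum_(j < N) (map_mpoly iota (f^`M(j))).@[fun j => a (v j).1 (v j).2]
                   * a (mshift (v j).1 i) (v j).2
    + (map_mpoly iota (map_mpoly (d i) f)).@[fun j => a (v j).1 (v j).2] = 0.

Definition separable_leader (K L : fieldType) (iota : K -> L) (m n : nat)
    (a : MI m -> 'I_n -> L) (sigma : MI m) (k : 'I_n) : Prop :=
  separably_algebraic_over (gen_by iota a (fun xi h => olt xi h sigma k)) (a sigma k).

Definition minimal_separable_leader (K L : fieldType) (iota : K -> L) (m n : nat)
    (a : MI m -> 'I_n -> L) (sigma : MI m) (k : 'I_n) : Prop :=
  separable_leader iota a sigma k /\
  forall rho : MI m, mle rho sigma -> rho != sigma -> ~ separable_leader iota a rho k.

(* Main.v *)
Require Import Defs.
From HB Require Import structures.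
From mathcomp Require Import all_boot all_order all_algebra.
From mathcomp Require Import separable.
From mathcomp Require Import finmap monalg.
From mathcomp Require Import mpoly.
From mathcomp Require Import ring.
From Stdlib Require Import ClassicalEpsilon FunctionalExtensionality.
Import GRing.Theory.
Local Open Scope ring_scope.
Set Implicit Arguments. Unset Strict Implicit. Unset Printing Implicit Defensive.

(* Let r = |mu| and F = K(a_h^xi : |xi| < r). Only the F-linear relations among
   1 and the a_h^xi with |xi| = r are forced by differentiating relations over
   K, so level r is replaced by a generic solution b of these linear relations,
   in a purely transcendental extension U of F. This discards any
   inseparability at level r, and the differential condition gives derivations
   delta_i : F -> U.

   Call an index a leader if it lies above a separable leader of level < r or
   above one of level r that is linear over its predecessors. The values at the
   other indices are independent variables; at a leader of level > r the value
   is D_i of the value at some leader just below, by recursion along the order.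
   The choice of i is irrelevant: two minimal leaders below sigma are both
   <= mu, so is their supremum, and |sigma| > |mu| leaves an l such that
   sigma - eps_l is above both; hence it suffices to compare sigma - eps_i and
   sigma - eps_l when sigma - eps_i - eps_l is itself a leader. There the
   commutator [D_i, D_l] is a derivation killing K and all smaller values, so it
   kills the value at a leader, which is separably algebraic over them. *)

(** * Derivations and subfields *)

Section Derivations.
Variables (R U : comNzRingType) (j : R -> U).

(** Derivations with values in [U], regarded as an [R]-module through [j]. The target must be larger
    than the source, because differentiating [F] produces values of level r. *)
Definition derivation_along (delta : R -> U) : Prop :=
  (forall x y, delta (x + y) = delta x + delta y) /\
  (forall x y, delta (x * y) = j x * delta y + delta x * j y).

Variable delta : R -> U.
Hypothesis delta_der : derivation_along delta.

Lemma derivD x y : delta (x + y) = delta x + delta y.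
Proof. exact: delta_der.1. Qed.

Lemma derivM x y : delta (x * y) = j x * delta y + delta x * j y.
Proof. exact: delta_der.2. Qed.

Lemma deriv0 : delta 0 = 0.
Proof. by apply: (addrI (delta 0)); rewrite -derivD !addr0. Qed.

Lemma derivN x : delta (- x) = - delta x.
Proof. by apply: (addrI (delta x)); rewrite -derivD !subrr deriv0. Qed.

Lemma derivB x y : delta (x - y) = delta x - delta y.
Proof. by rewrite derivD derivN. Qed.

Lemma deriv_sum I (s : seq I) (P : pred I) (f : I -> R) :
  delta (\sum_(i <- s | P i) f i) = \sum_(i <- s | P i) delta (f i).
Proof. exact: (big_morph delta derivD deriv0). Qed.

End Derivations.

Lemma is_derivation_along (U : comNzRingType) (D : U -> U) :
  is_derivation D -> derivation_along id D.
Proof. by []. Qed.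

Section DerivationsOfField.
Variable U : fieldType.
Implicit Types D E : U -> U.

Lemma derivation_commutator D E : is_derivation D -> is_derivation E ->
  is_derivation (fun x => D (E x) - E (D x)).
Proof.
move=> hD hE; split=> x y.
  by rewrite hD.1 hE.1 hD.1 hE.1 opprD addrACA.
by rewrite hD.2 hE.2 hD.1 hE.1 !hD.2 !hE.2; ring.
Qed.

Lemma derivation_sub D E : is_derivation D -> is_derivation E ->
  is_derivation (fun x => D x - E x).
Proof.
move=> hD hE; split=> x y; first by rewrite hD.1 hE.1 opprD addrACA.
by rewrite hD.2 hE.2; ring.
Qed.

Lemma derivation0 D : is_derivation D -> D 0 = 0.
Proof. by move=> hD; apply: deriv0 (is_derivation_along hD). Qed.

Lemma derivation1 D : is_derivation D -> D 1 = 0.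
Proof.
move=> hD; apply: (addrI (D 1)); rewrite addr0.
by have := hD.2 1 1; rewrite !mulr1 mul1r => <-.
Qed.

(** Reduces the vanishing of a derivation on a generated field to its vanishing on generators; [j]
    allows the test to run inside a smaller field. *)
Lemma derivation_kernel_subfield (F : fieldType) (j : {rmorphism F -> U}) D :
  is_derivation D -> subfield_closed (fun x => D (j x) = 0).
Proof.
move=> hD; split=> [|x y x0 y0|x y x0 y0|x x0].
- by rewrite rmorph1 derivation1.
- by rewrite rmorphB (derivB (is_derivation_along hD)) x0 y0 subrr.
- by rewrite rmorphM hD.2 x0 y0 mulr0 mul0r addr0.
have [->|nz] := eqVneq x 0.
  by rewrite invr0 rmorph0 derivation0.
have jnz : j x != 0 by rewrite fmorph_eq0.
apply: (mulfI jnz); rewrite mulr0.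
have := derivation1 hD; rewrite -(rmorph1 j) -(divff nz) rmorphM hD.2 x0.
by rewrite mul0r addr0.
Qed.

End DerivationsOfField.

(* If [e f = y * e g], a derivation extending [E] must satisfy
   [E f = e g * delta y + y * E g], which determines [delta y]. *)
Lemma fraction_derivation (R : comNzRingType) (F U : fieldType)
    (e : {rmorphism R -> F}) (j : {rmorphism F -> U}) (E : R -> U) :
  (forall y, exists f g, e g != 0 /\ e f = y * e g) ->
  derivation_along (j \o e) E -> (forall f, e f = 0 -> E f = 0) ->
  exists delta, derivation_along j delta /\ forall f, delta (e f) = E f.
Proof.
move=> frac Eder Eker.
have [delta deltaP] : exists delta : F -> U, forall y f g, e f = y * e g ->
    E f = j (e g) * delta y + j y * E g.
  suff h y : exists z, forall f g, e f = y * e g ->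
      E f = j (e g) * z + j y * E g.
    exists (fun y => proj1_sig (constructive_indefinite_description _ (h y))).
    by move=> y; case: constructive_indefinite_description.
  have [f0 [g0 [g0nz ef0]]] := frac y.
  have jnz : j (e g0) != 0 by rewrite fmorph_eq0.
  exists ((E f0 - j y * E g0) / j (e g0)) => f g ef.
  (* Two presentations of [y] cross-multiply to an element of the kernel of [e], where [E] vanishes;
     so the value found from [f0], [g0] fits every [f], [g]. *)
  have : E (f0 * g - f * g0) = 0.
    by apply: Eker; rewrite rmorphB !rmorphM ef0 ef mulrAC subrr.
  rewrite (derivB Eder) !(derivM Eder) /= ef0 ef !rmorphM => /eqP.
  rewrite subr_eq0 => /eqP eqE; apply: (mulfI jnz).
  rewrite mulrDr mulrCA [j (e g0) * (_ / _)]mulrC divfK //.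
  have -> : j (e g0) * E f = E f * j (e g0) by rewrite mulrC.
  have -> : E f * j (e g0) = (j y * j (e g0) * E g + E f0 * j (e g))
     - j y * j (e g) * E g0 by rewrite eqE; ring.
  by ring.
exists delta; split; last first.
  move=> f; have := deltaP (e f) f 1; rewrite rmorph1 mulr1 => /(_ erefl).
  have E1 : E 1 = 0.
    apply: (addrI (E 1)); rewrite addr0.
    by have := derivM Eder 1 1; rewrite /= !rmorph1 !mulr1 mul1r => <-.
  by rewrite rmorph1 mul1r E1 mulr0 addr0.
split=> x y.
  have [f1 [g1 [g1nz e1]]] := frac x; have [f2 [g2 [g2nz e2]]] := frac y.
  have h : e (f1 * g2 + f2 * g1) = (x + y) * e (g1 * g2).
    by rewrite rmorphD !rmorphM e1 e2 /=; ring.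
  have jnz : j (e g1) * j (e g2) != 0 by rewrite mulf_neq0 // fmorph_eq0.
  apply: (mulfI jnz); have := deltaP _ _ _ h.
  rewrite (derivD Eder) !(derivM Eder) /= e1 e2 (deltaP _ _ _ e1) (deltaP _ _ _ e2).
  rewrite !rmorphM rmorphD => eqE; apply: (addIr _ (etrans (esym eqE) _)); ring.
have [f1 [g1 [g1nz e1]]] := frac x; have [f2 [g2 [g2nz e2]]] := frac y.
have h : e (f1 * f2) = (x * y) * e (g1 * g2).
  by rewrite !rmorphM e1 e2 /=; ring.
have jnz : j (e g1) * j (e g2) != 0 by rewrite mulf_neq0 // fmorph_eq0.
apply: (mulfI jnz); have := deltaP _ _ _ h.
rewrite !(derivM Eder) /= e1 e2 (deltaP _ _ _ e1) (deltaP _ _ _ e2).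
rewrite !rmorphM => eqE; apply: (addIr _ (etrans (esym eqE) _)); ring.
Qed.

(** * Subfields given by predicates, as fields in their own right *)

Section Subfield.
Variables (L : fieldType) (S : L -> Prop).
Hypothesis Scl : subfield_closed S.

(** A classical decision makes the predicate boolean, so that the subfield becomes a subtype
    inheriting the field structure. *)
Definition in_subfield : {pred L} := fun x => excluded_middle_informative (S x).

Lemma in_subfieldP x : reflect (S x) (x \in in_subfield).
Proof.
rewrite unfold_in /in_subfield.
by case: excluded_middle_informative => h; constructor.
Qed.

Lemma in_subfield_divring_closed : divring_closed in_subfield.
Proof.
case: Scl => S1 SB SM SV; split=> [|x y|x y]; first exact/in_subfieldP.
  by move=> /in_subfieldP x_S /in_subfieldP y_S; apply/in_subfieldP/SB.
by move=> /in_subfieldP x_S /in_subfieldP y_S; apply/in_subfieldP/SM/SV.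
Qed.

HB.instance Definition _ :=
  GRing.isDivringClosed.Build L in_subfield in_subfield_divring_closed.

Record subfield_type := SubfieldElt { subfield_val :> L; _ : subfield_val \in in_subfield }.

HB.instance Definition _ := [isSub for subfield_val].
HB.instance Definition _ := [Choice of subfield_type by <:].
HB.instance Definition _ := [SubChoice_isSubIntegralDomain of subfield_type by <:].
HB.instance Definition _ := [SubIntegralDomain_isSubField of subfield_type by <:].

Lemma subfield_exists : exists (F : fieldType) (j : {rmorphism F -> L}),
  forall x, S x <-> exists y, x = j y.
Proof.
exists subfield_type, (\val : {rmorphism subfield_type -> L}) => x.
split=> [xS|[y ->]]; first by exists (SubfieldElt (introT (in_subfieldP x) xS)).
exact/in_subfieldP/(valP y).
Qed.

End Subfield.

Lemma subfield_closed0 (L : fieldType) (S : L -> Prop) : subfield_closed S -> S 0.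
Proof. by case=> S1 SB _ _; rewrite -(subrr 1); apply: SB. Qed.

Lemma subfield_closedD (L : fieldType) (S : L -> Prop) : subfield_closed S ->
  forall x y, S x -> S y -> S (x + y).
Proof.
move=> Scl x y Sx Sy; case: (Scl) => _ SB _ _.
by rewrite -[y]opprK -[- y]sub0r; apply: (SB) => //; apply: (SB) => //; apply: subfield_closed0.
Qed.

Lemma subfield_closed_sum (L : fieldType) (S : L -> Prop) I (s : seq I) (P : pred I)
    (f : I -> L) :
  subfield_closed S -> (forall i, P i -> S (f i)) -> S (\sum_(i <- s | P i) f i).
Proof.
by move=> Scl Sf; apply: big_ind => //; [exact: subfield_closed0|exact: subfield_closedD].
Qed.

(** * Rational functions in an arbitrary set of variables *)

Lemma fractionP (R : idomainType) (y : {fraction R}) : 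
  exists p q : R, FracField.tofrac q != 0 /\ FracField.tofrac p = y * FracField.tofrac q.
Proof.
elim/quotW: y => f; exists f.1, f.2.
have nz := denom_ratioP f; rewrite tofrac_eq0; split=> //.
unlock FracField.tofrac; rewrite -[RHS]FracField.pi_mul; apply/eqmodP => /=.
rewrite /FracField.mulf FracField.equivfE !numden_Ratio ?oner_eq0 ?mulr1 //.
by rewrite !mul1r mulrC.
Qed.

(** Polynomials in the possibly infinitely many variables [J], as the monoid algebra of the free
    commutative monoid on [J]. *)
Definition polyring (F : fieldType) (J : choiceType) := {malg F[{cmonom J}]}.
HB.instance Definition _ F J := GRing.ComNzRing.on (polyring F J).

Section PolyringIntegral.
Variables (F : fieldType) (J : choiceType).
Local Notation R := (polyring F J).

Lemma polyring_ind (P : R -> Prop) :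
  P 0 -> (forall p q, P p -> P q -> P (p + q)) ->
  (forall c m, P (<< c *g m >>)) -> forall p, P p.
Proof. by move=> P0 PD PU p; rewrite (monalgE p); apply: big_ind => // m _. Qed.

Lemma polyringUM (c c' : F) (m m' : cmonom J) :
  (<< c *g m >> : R) * << c' *g m' >> = << c * c' *g mmul m m' >>.
Proof. exact: fgmulUU. Qed.

Section Restrict.
Variable s : seq J.

(* Variables outside [s] are specialised to [1]. *)
Definition restrict_monomial (m : cmonom J) : mpoly (size s) F :=
  'X_[[multinom m (tnth (in_tuple s) i) | i < size s]].

Lemma restrict_monomial_morph : monalg.mmorphism restrict_monomial.
Proof.
split=> [m m'|].
  rewrite /restrict_monomial -mpolyXD; congr mpolyX.
  by apply/mnmP => i; rewrite mnmDE !mnmE cmM.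
rewrite /restrict_monomial -[RHS]mpolyX0; congr mpolyX.
by apply/mnmP => i; rewrite mnm0E mnmE cm1.
Qed.

HB.instance Definition _ :=
  monalg.isMultiplicative.Build (cmonom J) _ restrict_monomial restrict_monomial_morph.

Definition restrict : R -> mpoly (size s) F :=
  monalg.mmap (@mpolyC (size s) F) restrict_monomial.

HB.instance Definition _ := GRing.RMorphism.copy restrict
  (monalg.mmap (@mpolyC (size s) F) restrict_monomial).

(** Monomials supported in [s] are determined by their exponents on [s], so no two monomials of [p]
    merge and each coefficient survives. *)
Lemma restrict_eq0 (p : R) :
  (forall m, m \in monalg.msupp p -> {subset finsupp m <= s}) ->
  restrict p = 0 -> p = 0.
Proof.
move=> sub rp0; apply/eqP; rewrite -monalg.msupp_eq0; apply/negPn/negP.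
case/fset0Pn => m0 m0p; have := congr1 (mcoeff [multinom m0 (tnth (in_tuple s) i) | i < size s]) rp0.
rewrite mcoeff0 /restrict monalg.mmapE raddf_sum /= (big_fsetD1 m0) //=.
rewrite mul_mpolyC mcoeffZ mcoeffX eqxx mulr1 big1_fset ?addr0.
  by move/eqP; rewrite monalg.mcoeff_eq0 m0p.
move=> m; rewrite in_fsetD1 => /andP[mm0 mp] _.
rewrite mul_mpolyC mcoeffZ mcoeffX; case: eqP => [/mnmP eqm|_]; last by rewrite mulr0.
case/negP: mm0; apply/cmP => i.
have [/(tnthP (in_tuple s))[k ->]|si] := boolP (i \in s).
  by have := eqm k; rewrite !mnmE.
have h m' : m' \in monalg.msupp p -> m' i = 0%N.
  by move=> m'p; apply/eqP; rewrite cmE_eq0; apply: contra si; apply: sub.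
by rewrite !h.
Qed.

End Restrict.

(** Two polynomials involve finitely many variables altogether, so a vanishing product can be tested
    in a polynomial ring in finitely many variables. *)
Lemma polyring_integral (p q : R) : p * q = 0 -> (p == 0) || (q == 0).
Proof.
move=> pq0.
pose s := flatten [seq enum_fset (finsupp (cmonom_val m)) | m <- monalg.msupp p ++ monalg.msupp q].
have sub m : (m \in monalg.msupp p) || (m \in monalg.msupp q) -> {subset finsupp m <= s}.
  move=> mpq i im; apply/flattenP; exists (enum_fset (finsupp m)) => //.
  by apply: map_f; rewrite mem_cat.
have := congr1 (restrict s) pq0; rewrite rmorph0 rmorphM => /eqP.
rewrite mulf_eq0 => /orP[] /eqP h; apply/orP; [left|right]; apply/eqP.
  by apply: restrict_eq0 h => m mp; apply: sub; rewrite mp.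
by apply: restrict_eq0 h => m mp; apply: sub; rewrite mp orbT.
Qed.

(** Deciding invertibility classically yields the integral domain structure behind the fraction
    field without identifying the units. *)
Definition polyring_unit : {pred R} :=
  fun p => excluded_middle_informative (exists q, q * p = 1).

Lemma polyring_unitP p : reflect (exists q, q * p = 1) (p \in polyring_unit).
Proof.
rewrite unfold_in /polyring_unit.
by case: excluded_middle_informative => h; constructor.
Qed.

Definition polyring_inv (p : R) : R :=
  match excluded_middle_informative (exists q, q * p = 1) with
  | left h => proj1_sig (constructive_indefinite_description _ h)
  | right _ => p
  end.

Lemma polyring_mulVx : {in polyring_unit, left_inverse 1 polyring_inv *%R}.
Proof.
move=> p /polyring_unitP h; rewrite /polyring_inv.
by case: excluded_middle_informative => // h'; case: constructive_indefinite_description.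
Qed.

Lemma polyring_unitPl (p q : R) : q * p = 1 -> p \in polyring_unit.
Proof. by move=> qp; apply/polyring_unitP; exists q. Qed.

Lemma polyring_invr_out : {in [predC polyring_unit], polyring_inv =1 id}.
Proof.
move=> p; rewrite inE => /polyring_unitP h; rewrite /polyring_inv.
by case: excluded_middle_informative.
Qed.

HB.instance Definition _ := GRing.ComNzRing_hasMulInverse.Build R
  polyring_mulVx polyring_unitPl polyring_invr_out.
HB.instance Definition _ := GRing.ComUnitRing_isIntegral.Build R polyring_integral.

End PolyringIntegral.


(* [R] is kept abstract: conversion unfolds the multiplication of {malg _[_]}
   and does not terminate in reasonable time on the concrete ring. *)
Section RationalFunctions.
Variables (F U : fieldType) (J : choiceType) (R : comNzRingType).
Variables (mono : F -> cmonom J -> R) (e : {rmorphism R -> U}).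
Hypothesis mono_ind : forall P : R -> Prop, P 0 ->
  (forall p q, P p -> P q -> P (p + q)) -> (forall c m, P (mono c m)) -> forall p, P p.
Hypothesis monoB : forall c c' m, mono (c - c') m = mono c m - mono c' m.
Hypothesis monoM : forall c c' m m', mono c m * mono c' m' = mono (c * c') (mmul m m').
Hypothesis mono1 : mono 1 mone = 1.
Hypothesis mono_extend : forall (f : {additive F -> U}) (h : cmonom J -> U),
  exists E : R -> U, (forall p q, E (p + q) = E p + E q) /\
                     forall c m, E (mono c m) = f c * h m.
Hypothesis e_inj : forall p, e p = 0 -> p = 0.
Hypothesis mono_neq0 : forall m, mono 1 m <> 0.
Hypothesis fracP : forall y, exists p q, e q != 0 /\ e p = y * e q.

Definition ratconst (c : F) : U := e (mono c mone).

Lemma ratconstB : {morph ratconst : c c' / c - c'}.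
Proof. by move=> c c'; rewrite /ratconst monoB rmorphB. Qed.

Lemma ratconst_monoid_morphism : monoid_morphism ratconst.
Proof.
by split=> [|c c']; rewrite /ratconst ?mono1 ?rmorph1 // -rmorphM monoM mul1m.
Qed.

HB.instance Definition _ := GRing.isZmodMorphism.Build F U ratconst ratconstB.
HB.instance Definition _ :=
  GRing.isMonoidMorphism.Build F U ratconst ratconst_monoid_morphism.

Definition ratmonomial (m : cmonom J) : U := e (mono 1 m).
Definition ratvar (i : J) : U := ratmonomial (ucm i).

Lemma ratmonomialM m m' : ratmonomial (mmul m m') = ratmonomial m * ratmonomial m'.
Proof. by rewrite /ratmonomial -rmorphM monoM mulr1. Qed.

Lemma ratmonomial1 : ratmonomial mone = 1.
Proof. by rewrite /ratmonomial mono1 rmorph1. Qed.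

Lemma ratfunU c m : e (mono c m) = ratconst c * ratmonomial m.
Proof. by rewrite /ratmonomial /ratconst -rmorphM monoM mulr1 mul1m. Qed.

Lemma ratvar_neq0 i : ratvar i != 0.
Proof. by apply/eqP => /e_inj; apply: mono_neq0. Qed.

Lemma ratfun_generated (S : U -> Prop) : subfield_closed S ->
  (forall c, S (ratconst c)) -> (forall i, S (ratvar i)) -> forall y, S y.
Proof.
move=> Scl Sc Sv y; case: (Scl) => S1 SB SM SV.
have Sm m : S (ratmonomial m).
  have [k] := ubnP (monalg.mdeg m); elim: k m => // k IH m.
  have [->|] := eqVneq m mone; first by rewrite ratmonomial1.
  move=> m1; have [|[i im]] := fset_0Vmem (finsupp m).
    move=> m0; case/negP: m1; apply/cmP => i; rewrite cm1; apply/eqP.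
    by rewrite cmE_eq0 m0.
  have mi : (0 < m i)%N by rewrite lt0n cmE_neq0.
  have -> : m = mmul (ucm i) (divcm m (ucm i)).
    apply/eqP/cmP => l; rewrite cmM divcmE cmU.
    by case: eqVneq => [<-|_]; rewrite ?subn0 // subnKC.
  rewrite monalg.mdegM mdegU ratmonomialM => le; apply: SM; first exact: Sv.
  by apply: IH.
have Se p : S (e p).
  apply: (mono_ind (P := fun p => S (e p))) p => [|p q Sp Sq|c m].
  - by rewrite rmorph0; apply: subfield_closed0.
  - by rewrite rmorphD; apply: subfield_closedD.
  by rewrite ratfunU; apply: SM.
have [p [q [q0 epq]]] := fracP y.
by rewrite -[y](mulfK q0) -epq; apply: SM => //; apply: SV.
Qed.

Section Extension.
Variables (delta : F -> U) (u : J -> U).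
Hypothesis delta_der : derivation_along ratconst delta.

(** The logarithmic derivative of the monomial [m] when each variable [i] has derivative [u i]; it
    turns products into sums. *)
Definition logderiv (m : cmonom J) : U :=
  \sum_(i <- finsupp m) (u i / ratvar i) *+ m i.

Lemma logderivEw (m : cmonom J) (s : {fset J}) : (finsupp m `<=` s)%fset ->
  logderiv m = \sum_(i <- s) (u i / ratvar i) *+ m i.
Proof.
move=> le; rewrite /logderiv (big_fset_incl _ le) // => i _.
by rewrite -cmE_eq0 => /eqP ->.
Qed.

Lemma logderivM m m' : logderiv (mmul m m') = logderiv m + logderiv m'.
Proof.
rewrite {1}/logderiv mdomD (logderivEw (fsubsetUl _ (finsupp m'))).
rewrite (logderivEw (fsubsetUr (finsupp m) _)) -big_split /=.
by apply: eq_bigr => i _; rewrite cmM mulrnDr.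
Qed.

(** [E1] differentiates the coefficients and [E2] the monomials. Both sides of the product rule are
    biadditive, so it is checked on single terms. *)
Lemma polyderiv_exists : exists E : R -> U, derivation_along (idfun \o e) E /\
  forall c m, E (mono c m) = ratmonomial m * (delta c + ratconst c * logderiv m).
Proof.
pose delta_mixin := GRing.isZmodMorphism.Build F U delta (derivB delta_der).
have [E1 [E1D E1U]] := mono_extend (HB.pack delta delta_mixin) ratmonomial.
have [E2 [E2D E2U]] := mono_extend ratconst (fun m => ratmonomial m * logderiv m).
pose E p := E1 p + E2 p.
have EU c m : E (mono c m) = ratmonomial m * (delta c + ratconst c * logderiv m).
  by rewrite /E E1U E2U /= mulrDr mulrC [in RHS]mulrCA.
have ED p q : E (p + q) = E p + E q by rewrite /E E1D E2D addrACA.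
have E0 : E 0 = 0 by apply: (addrI (E 0)); rewrite -ED !addr0.
exists E; split=> //; split=> // p q /=; clearbody E.
apply: (mono_ind (P := fun p => E (p * q) = e p * E q + E p * e q)) p.
- by rewrite mul0r E0 rmorph0 !mul0r addr0.
- by move=> p p' IH IH'; rewrite mulrDl !ED IH IH' rmorphD !mulrDl addrACA.
move=> c m; apply: (mono_ind (P := fun q => E (_ * q) = e _ * E q + E _ * e q)) q.
- by rewrite mulr0 E0 rmorph0 !mulr0 addr0.
- by move=> p p' IH IH'; rewrite mulrDr !ED IH IH' rmorphD !mulrDr addrACA.
move=> c' m'; rewrite monoM !EU ratmonomialM logderivM !ratfunU.
rewrite (derivM delta_der) rmorphM /=.
move: (ratconst c) (ratconst c') (delta c) (delta c') => x x' y y'.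
move: (ratmonomial m) (ratmonomial m') (logderiv m) (logderiv m') => z z' w w'.
by ring.
Qed.

Lemma ratfun_extension : exists D : U -> U, [/\ is_derivation D,
  forall c, D (ratconst c) = delta c & forall i, D (ratvar i) = u i].
Proof.
have [E [Eder EU]] := polyderiv_exists.
have [|D [Dder DE]] := fraction_derivation fracP Eder.
  by move=> p /e_inj ->; apply: (deriv0 Eder).
have delta1 : delta 1 = 0.
  apply: (addrI (delta 1)); rewrite addr0.
  by have := derivM delta_der 1 1; rewrite rmorph1 !mulr1 mul1r => <-.
exists D; split=> // [c|i].
  rewrite /ratconst DE EU ratmonomial1 mul1r /logderiv mdom1 big_seq_fset0.
  by rewrite mulr0 addr0.
rewrite /ratvar {1}/ratmonomial DE EU delta1 rmorph1 add0r mul1r.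
rewrite /logderiv mdomU big_seq_fset1 cmUU mulr1n mulrC divfK //; exact: ratvar_neq0.
Qed.

End Extension.

End RationalFunctions.

(** Algebraic independence of the [x i] is recorded through its differential consequence: a
    derivation on [F] extends with arbitrary values at the variables. *)
Lemma purely_transcendental_extension (F : fieldType) (J : choiceType) :
  exists (U : fieldType) (j : {rmorphism F -> U}) (x : J -> U),
    (forall S : U -> Prop, subfield_closed S -> (forall c, S (j c)) ->
       (forall i, S (x i)) -> forall y, S y) /\
    (forall (delta : F -> U) (u : J -> U), derivation_along j delta ->
       exists D, [/\ is_derivation D, forall c, D (j c) = delta c &
                      forall i, D (x i) = u i]).
Proof.
pose R := polyring F J; pose U := {fraction R}.
pose e := @FracField.tofrac R : {rmorphism R -> U}.
pose mono (c : F) (m : cmonom J) : R := << c *g m >>.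
have monoB c c' m : mono (c - c') m = mono c m - mono c' m by apply: raddfB.
have monoM c c' m m' : mono c m * mono c' m' = mono (c * c') (mmul m m').
  exact: polyringUM.
have mono1 : mono 1 mone = 1 by [].
have mono_neq0 m : mono 1 m <> 0.
  by move/eqP; rewrite monalgU_eq0 oner_eq0.
have e_inj p : e p = 0 -> p = 0 by move/eqP; rewrite tofrac_eq0 => /eqP.
have frac y := fractionP (R := R) y.
exists U, (ratconst mono e), (ratvar mono e); split.
  by move=> S; apply: ratfun_generated => //; apply: polyring_ind.
move=> delta u; apply: ratfun_extension => //; first exact: polyring_ind.
move=> f h; exists (monalg.mmap f h); split; first exact: raddfD.
by move=> c m; apply: monalg.mmapU.
Unshelve. all: assumption.
Qed.

(** * Orders on indices *)

Lemma lexle_refl s : lexle s s.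
Proof. by elim: s => //= x s ->; rewrite eqxx orbT. Qed.

Lemma lexle_total s t : lexle s t || lexle t s.
Proof.
elim: s t => [|x s IH] [|y t] //=.
by case: (ltngtP x y) => //= _; apply: IH.
Qed.

Lemma lexle_anti s t : lexle s t -> lexle t s -> s = t.
Proof.
elim: s t => [|x s IH] [|y t] //=.
by case: (ltngtP x y) => //= -> st ts; rewrite (IH t).
Qed.

Lemma lexle_trans s t u : lexle s t -> lexle t u -> lexle s u.
Proof.
elim: s t u => [|x s IH] [|y t] [|z u] //=.
case: (ltngtP x y) => //= [xy _|-> st].
  by case: (ltngtP y z) => //= [yz|<-]; rewrite ?(ltn_trans xy yz) ?xy.
by case: (ltngtP y z) => //= _; apply: IH.
Qed.

Lemma lexle_map_add T (s : seq T) (f g c : T -> nat) :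
  lexle [seq (f i + c i)%N | i <- s] [seq (g i + c i)%N | i <- s] =
  lexle (map f s) (map g s).
Proof. by elim: s => //= x s ->; rewrite ltn_add2r eqn_add2r. Qed.

(** The length is fixed because over all lengths there are infinite descents such as 1, 01, 001. The
    induction is on the length, then on a bound for the head, then on accessibility of the tail. *)
Lemma lexlt_Acc N s : size s = N ->
  Acc (fun s t => [&& size s == size t, lexle s t & s != t]) s.
Proof.
elim: N s => [|N IHN] s sz.
  constructor=> t /and3P[]; rewrite (size0nil sz) => /eqP/size0nil -> _ ne.
  by have := eqxx ([::] : seq nat); rewrite (negbTE ne).
case: s sz => [|x s] sz.
  discriminate sz.
have {}sz : size s = N by exact: eq_add_S sz.
have [b] := ubnP x; elim: b x s sz => [|b IHx] x s sz lexb; first by have := ltn0 x; rewrite lexb.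
have acc := IHN s sz; elim: acc sz => {}s _ IHs sz; constructor=> -[|y t] /and3P[/eqP sz'].
  discriminate sz'.
have {}sz' : size t = N by rewrite -sz; apply: eq_add_S sz'.
rewrite /=; case: (ltngtP y x) => [yx _ _|_ le|->] /=; last 1 first.
- move=> ts; rewrite eqseq_cons eqxx /= => nts.
  by apply: IHs; rewrite ?sz' ?sz ?ts ?nts ?eqxx.
- by apply: IHx; [exact: sz'|apply: leq_trans yx _].
discriminate le.
Qed.

Section MultiIndices.
Variable m : nat.
Implicit Types xi eta sigma tau rho : MI m.

Lemma mshiftE xi i j : mshift xi i j = (xi j + (j == i))%N.
Proof. by rewrite ffunE. Qed.

Lemma msum_mshift xi i : msum (mshift xi i) = (msum xi).+1.
Proof.
rewrite /msum (eq_bigr _ (fun j _ => mshiftE xi i j)) big_split /=.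
by rewrite -big_mkcond /= big_pred1_eq addn1.
Qed.

Lemma mshiftC xi i j : mshift (mshift xi i) j = mshift (mshift xi j) i.
Proof. by apply/ffunP => l; rewrite !mshiftE addnAC. Qed.

Lemma mshift_inj i : injective (@mshift m ^~ i).
Proof.
by move=> xi eta /ffunP h; apply/ffunP => j; have := h j; rewrite !mshiftE => /addIn.
Qed.

Lemma mleP xi eta : reflect (forall i, (xi i <= eta i)%N) (mle xi eta).
Proof. exact: forallP. Qed.

Lemma mle_refl xi : mle xi xi.
Proof. exact/mleP. Qed.

Lemma mle_trans xi eta sigma : mle xi eta -> mle eta sigma -> mle xi sigma.
Proof. by move=> /mleP h /mleP h'; apply/mleP => i; apply: leq_trans (h' i). Qed.

Lemma mle_mshift xi i : mle xi (mshift xi i).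
Proof. by apply/mleP => j; rewrite mshiftE leq_addr. Qed.

Lemma mle_msum xi eta : mle xi eta -> (msum xi <= msum eta)%N.
Proof. by move=> /mleP h; apply: leq_sum. Qed.

Lemma mle_msum_lt xi eta : mle xi eta -> xi != eta -> (msum xi < msum eta)%N.
Proof.
move=> le; apply: contraNltn => ge; apply/eqP/ffunP => i; apply/eqP.
move/mleP: (le) => lei; have := ge; rewrite /msum (bigD1 i) //= [leqRHS](bigD1 i) //=.
have: (\sum_(j | j != i) xi j <= \sum_(j | j != i) eta j)%N by apply: leq_sum.
move: (lei i); rewrite eqn_leq => -> /= h1 h2.
by rewrite -(leq_add2r (\sum_(j < m | j != i) eta j)%N) (leq_trans h2) // leq_add2l.
Qed.

Lemma mle_unshift rho sigma i : mle rho sigma -> (rho i < sigma i)%N ->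
  exists2 tau, sigma = mshift tau i & mle rho tau.
Proof.
move=> /mleP le lti; exists [ffun j => (sigma j - (j == i))%N].
  apply/ffunP => j; rewrite mshiftE ffunE subnK //.
  by case: eqVneq => [->|] //; apply: leq_ltn_trans lti.
apply/mleP => j; rewrite ffunE; case: eqVneq => [->|_]; last by rewrite subn0.
by rewrite subn1 -ltnS prednK //; apply: leq_ltn_trans lti.
Qed.

Lemma mle_lt_exists rho sigma : mle rho sigma -> (msum rho < msum sigma)%N ->
  exists i, (rho i < sigma i)%N.
Proof.
move=> /mleP le lt; apply/existsP; move: lt; rewrite ltnNge; apply: contraNT.
by rewrite negb_exists => /forallP h; apply: leq_sum => i _; rewrite leqNgt.
Qed.

Lemma mle_ind (P : MI m -> Prop) rho :
  P rho -> (forall tau i, mle rho tau -> P tau -> P (mshift tau i)) ->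
  forall sigma, mle rho sigma -> P sigma.
Proof.
move=> Prho Pshift sigma; have [k] := ubnP (msum sigma).
elim: k sigma => // k IH sigma lek le.
have [<-//|ne] := eqVneq rho sigma.
have [i lti] := mle_lt_exists le (mle_msum_lt le ne).
have [tau eq_sigma le'] := mle_unshift le lti.
rewrite eq_sigma; apply: Pshift => //; apply: IH => //.
by move: lek; rewrite eq_sigma msum_mshift.
Qed.

End MultiIndices.

Section IndexOrder.
Variables (m n : nat).
Implicit Types p q : (MI m * 'I_n)%type.

Definition ilt p q := olt p.1 p.2 q.1 q.2.
Definition ile p q := ole p.1 p.2 q.1 q.2.

Lemma size_okey p : size (okey p.1 p.2) = (size [seq i : 'I_m <- enum 'I_m | (i < m.-1)%N]).+2.
Proof. by rewrite /okey /= size_map. Qed.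

Lemma okey_mshift xi i (k : 'I_n) : okey (mshift xi i) k =
  (msum xi + 1)%N :: (k + 0)%N ::
  [seq (xi j + (j == i))%N | j <- [seq j : 'I_m <- enum 'I_m | (j < m.-1)%N]].
Proof.
rewrite /okey msum_mshift addn1 addn0; congr [:: _, _ & _].
by apply: eq_map => j; rewrite mshiftE.
Qed.

(** The key omits only the last coordinate, which the total degree and the other coordinates
    recover. *)
Lemma okey_inj xi k eta g : (0 < m)%N -> @okey m n xi k = okey eta g -> (xi, k) = (eta, g).
Proof.
move=> m_gt0 [eqs /val_inj -> /eq_in_map eqe].
congr (_, _); apply/ffunP => i.
have lt (j : 'I_m) : (j < m.-1)%N -> xi j = eta j.
  by move=> ltj; apply: eqe; rewrite mem_filter mem_enum ltj.
have [|gei] := ltnP i m.-1; first exact: lt.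
have same j : j != i -> xi j = eta j.
  move=> ne; apply: lt; rewrite ltnNge; apply: contra ne => gej; apply/eqP/val_inj.
  have le_last (l : 'I_m) : (l <= m.-1)%N by rewrite -ltnS prednK.
  have := le_last i; have := le_last j => lej lei.
  by apply/eqP; rewrite eqn_leq (leq_trans lej gei) (leq_trans lei gej).
apply/eqP; move/eqP: eqs; rewrite /msum (bigD1 i) //= [in X in _ == X](bigD1 i) //=.
by rewrite (eq_bigr _ (fun j => @same j)) eqn_add2r.
Qed.

Lemma ilt_wf : well_founded ilt.
Proof.
move=> p; have [s eqs] : exists s, okey p.1 p.2 = s by exists (okey p.1 p.2).
have acc := lexlt_Acc (erefl (size s)).
elim: acc p eqs => {}s _ IH p eqs; apply: Acc_intro => q /andP[le ne].
apply: (IH (okey q.1 q.2)) (erefl _).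
by rewrite /ole in le; rewrite -eqs !size_okey eqxx le ne.
Qed.

Lemma ile_refl p : ile p p. Proof. exact: lexle_refl. Qed.

Lemma ile_total p q : ile p q || ile q p. Proof. exact: lexle_total. Qed.

Lemma iltW p q : ilt p q -> ile p q. Proof. by case/andP. Qed.

Lemma ilt_ile_trans p q r : ilt p q -> ile q r -> ilt p r.
Proof.
case/andP=> le ne le'; apply/andP; split; first exact: lexle_trans le le'.
by apply: contra ne => /eqP eqpr; apply/eqP; apply: lexle_anti le _; rewrite eqpr.
Qed.

Lemma ilt_trans p q r : ilt p q -> ilt q r -> ilt p r.
Proof. by move=> lt /iltW; apply: ilt_ile_trans. Qed.

Lemma ile_eqVlt p q : (0 < m)%N -> ile p q -> p = q \/ ilt p q.
Proof.
case: p q => [xi k] [eta g] m_gt0 le.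
have [/(okey_inj m_gt0)->|ne] := eqVneq (okey xi k) (okey eta g); first by left.
by right; apply/andP.
Qed.

Lemma ile_msum p q : ile p q -> (msum p.1 <= msum q.1)%N.
Proof. by case/orP => [/ltnW|/andP[/eqP->]]. Qed.

Lemma ilt_msum p q : (msum p.1 < msum q.1)%N -> ilt p q.
Proof.
move=> lt; apply/andP; split; first by rewrite /ole /= lt.
by apply: contraTneq lt => -[->]; rewrite ltnn.
Qed.

Lemma ilt_mshift p i : ilt p (mshift p.1 i, p.2).
Proof. by apply: ilt_msum; rewrite /= msum_mshift. Qed.

Lemma ilt_mshift2 p q i : ilt p q -> ilt (mshift p.1 i, p.2) (mshift q.1 i, q.2).
Proof.
case: p q => [xi k] [eta g] /andP[le ne]; apply/andP; split.
  move: le; rewrite /ole !okey_mshift /= lexle_map_add.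
  by rewrite ltn_add2r eqn_add2r !addn0.
apply: contra ne; rewrite !okey_mshift !eqseq_cons eqn_add2r !addn0.
move=> /and3P[/= -> -> /eqP/eq_in_map eqm] /=.
by apply/eqP/eq_in_map => j /eqm /addIn.
Qed.

End IndexOrder.

(** * Prolongation above level r *)

(** [G] expects a total function, so the recursion feeds it [b] truncated to the predecessors of
    [p], with default [z]. The truncation stays visible in the equation. *)
Lemma wf_fixpoint (T U : Type) (R : rel T) (z : U) (G : (T -> U) -> T -> U) :
  well_founded R ->
  exists b : T -> U, forall p, b p = G (fun q => if R q p then b q else z) p.
Proof.
move=> wfR; pose H p (rec : forall q, R q p -> U) :=
  G (fun q => match Bool.bool_dec (R q p) true with left h => rec q h | _ => z end) p.
exists (Fix wfR (fun=> U) H) => p; rewrite Fix_eq => [|{}p f g eqfg].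
  rewrite {1}/H; congr G; apply: functional_extensionality => q.
  by case: Bool.bool_dec => [h|/negP/negbTE ->]; rewrite ?h.
rewrite /H; congr G; apply: functional_extensionality => q.
by case: Bool.bool_dec => h //; apply: eqfg.
Qed.

Section Prolongation.
Variables (m n : nat) (K F U : fieldType).
Variables (kappa : {rmorphism K -> F}) (j : {rmorphism F -> U}).
Variables (d : 'I_m -> K -> K).
Local Notation idx := (MI m * 'I_n)%type.
Implicit Types p q : idx.
Variables (x : idx -> U) (r : nat) (mu : MI m).

Definition ishift p i : idx := (mshift p.1 i, p.2).

(* The derivation-theoretic form of "[b p] is separably algebraic over K and
   the smaller values"; unlike the latter it passes to [ishift p i] formally. *)
Definition determined (b : idx -> U) p := forall Delta : U -> U,
  is_derivation Delta -> (forall c, Delta (j (kappa c)) = 0) ->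
  (forall q, ilt q p -> Delta (b q) = 0) -> Delta (b p) = 0.

Hypothesis m_gt0 : (0 < m)%N.
Hypothesis d_comm : forall i l c, d i (d l c) = d l (d i c).
Hypothesis extend : forall (delta : F -> U) (u : idx -> U), derivation_along j delta ->
  exists D, [/\ is_derivation D, forall c, D (j c) = delta c & forall p, D (x p) = u p].

(** The commutator of [Delta] and [D] is a derivation killing K and all values below [p], hence
    [b p]; as [Delta] kills [b p] too, it kills [D (b p)]. *)
Lemma determined_ishift (b : idx -> U) (D : U -> U) i p :
  is_derivation D -> (forall c, D (j (kappa c)) = j (kappa (d i c))) ->
  (forall q, ile q p -> D (b q) = b (ishift q i)) ->
  determined b p -> determined b (ishift p i).
Proof.
move=> Dder DK Db det Delta Delta_der DeltaK Deltab.
have D0 : D 0 = 0 by apply: derivation0.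
rewrite -Db; last exact: ile_refl.
suff : Delta (D (b p)) - D (Delta (b p)) = 0.
  by rewrite Deltab ?D0 ?subr0 //; apply: ilt_mshift.
apply: (det (fun y => Delta (D y) - D (Delta y))).
- exact: derivation_commutator.
- by move=> c; rewrite DK !DeltaK D0 subr0.
move=> q ltqp; rewrite Db ?iltW // !Deltab ?D0 ?subr0 //.
  exact: ilt_trans ltqp (ilt_mshift _ _).
exact: ilt_mshift2.
Qed.

Variables (a : idx -> F) (b0 : idx -> U) (delta : 'I_m -> F -> U).
Variable lead0 : idx -> Prop.
Hypothesis generated : forall S : U -> Prop, subfield_closed S ->
  (forall c, S (j (kappa c))) -> (forall p, (msum p.1 < r)%N -> S (j (a p))) ->
  (forall p, S (x p)) -> forall y, S y.
Hypothesis msum_mu : msum mu = r.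
Hypothesis b0_lt : forall p, (msum p.1 < r)%N -> b0 p = j (a p).
Hypothesis delta_der : forall i, derivation_along j (delta i).
Hypothesis delta_const : forall i c, delta i (kappa c) = j (kappa (d i c)).
Hypothesis delta_gen :
  forall i p, (msum p.1 < r)%N -> delta i (a p) = b0 (ishift p i).
Hypothesis lead0_determined :
  forall p, (msum p.1 <= r)%N -> lead0 p -> determined b0 p.
Hypothesis lead0_free : forall p, msum p.1 = r -> ~ lead0 p -> b0 p = x p.
Hypothesis lead0_minimal : forall p, (msum p.1 <= r)%N -> lead0 p ->
  (forall rho, mle rho p.1 -> rho != p.1 -> ~ lead0 (rho, p.2)) -> mle p.1 mu.

(** The bound on [rho] confines [lead0] to levels at most [r], where the hypotheses on it speak. *)
Definition lead p :=
  exists rho, [/\ mle rho p.1, (msum rho <= r)%N & lead0 (rho, p.2)].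

Definition leadb p : bool := excluded_middle_informative (lead p).

Lemma leadP p : reflect (lead p) (leadb p).
Proof. by rewrite /leadb; case: excluded_middle_informative => h; constructor. Qed.

Lemma lead_mle sigma tau k : mle sigma tau -> lead (sigma, k) -> lead (tau, k).
Proof. by move=> le [rho [le' lem l0]]; exists rho; split=> //; apply: mle_trans le. Qed.

(** Descending to a minimal [lead0] index below [p] makes [lead0_minimal] applicable; this is where
    the bound by [mu] enters. *)
Lemma lead_below_mu p : lead p -> exists rho, [/\ mle rho p.1, mle rho mu & lead (rho, p.2)].
Proof.
case: p => sigma k [rho [/= le lem l0]].
have [s] := ubnP (msum rho); elim: s rho le lem l0 => // s IH rho le lem l0 ltm.
have [[rho' [le' ne l0']]|nex] := classic (exists rho', [/\ mle rho' rho, rho' != rho & lead0 (rho', k)]).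
  have lt := mle_msum_lt le' ne.
  apply: (IH rho') => //; [exact: mle_trans le'  le|exact: ltnW (leq_trans lt lem)|].
  exact: leq_trans lt ltm.
exists rho; split=> //; last by exists rho; split=> //; apply: mle_refl.
apply: (lead0_minimal (p := (rho, k))) => // rho' le' ne l0'.
by apply: nex; exists rho'.
Qed.

Lemma lead_unshift p : (r < msum p.1)%N -> lead p ->
  exists iq : 'I_m * idx, p = ishift iq.2 iq.1 /\ lead iq.2.
Proof.
case: p => sigma k /= ltr [rho [/= le lem l0]].
have [i lti] := mle_lt_exists le (leq_ltn_trans lem ltr).
have [tau -> le'] := mle_unshift le lti.
by exists (i, (tau, k)); split=> //; exists rho.
Qed.

(** The derivative prescribed for [x p]. Where [b p] is the variable [x p], it is the next value;
    elsewhere the variable is made a constant, so that the derivations commute on it. *)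
Definition free_value (b : idx -> U) i p : U :=
  if (r <= msum p.1)%N && ~~ leadb p then b (ishift p i) else 0.

(** Choosing derivations for every candidate [b] at once lets the recursion differentiate before [b]
    is complete. *)
Lemma chosen_derivations : exists der : (idx -> U) -> 'I_m -> U -> U, forall b i,
  [/\ is_derivation (der b i), forall c, der b i (j c) = delta i c &
      forall p, der b i (x p) = free_value b i p].
Proof.
have ex b i := extend (free_value b i) (delta_der i).
exists (fun b i => proj1_sig (constructive_indefinite_description _ (ex b i))) => b i.
by case: constructive_indefinite_description.
Qed.

(** The values at leaders need the derivations, whose values at variables need [b]. The circle is
    broken by using, at [p], the derivation built from [b] truncated below [p]. *)
Lemma prolongation_values : exists (der : (idx -> U) -> 'I_m -> U -> U) (b : idx -> U),
  [/\ forall b i,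
      [/\ is_derivation (der b i), forall c, der b i (j c) = delta i c &
          forall p, der b i (x p) = free_value b i p],
      forall p, (msum p.1 <= r)%N -> b p = b0 p,
      forall p, (r <= msum p.1)%N -> ~ lead p -> b p = x p &
      forall p, (r < msum p.1)%N -> lead p -> exists i q, [/\ p = ishift q i, lead q &
        b p = der (fun q => if ilt q p then b q else 0) i (b q)]].
Proof.
have [der derP] := chosen_derivations; exists der.
(* Above level [r], an index is a leader exactly when some leader lies one shift below it, so the
   existence test also separates leaders from free indices. *)
pose G b p := if (msum p.1 <= r)%N then b0 p else
  match excluded_middle_informative
    (exists iq : 'I_m * idx, p = ishift iq.2 iq.1 /\ lead iq.2) with
  | left h => let iq := proj1_sig (constructive_indefinite_description _ h) in
              der b iq.1 (b iq.2)
  | right _ => x p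
  end.
have [b bE] := wf_fixpoint 0 G (@ilt_wf m n); exists b; split=> // p.
- by move=> le; rewrite bE /G le.
- rewrite leq_eqVlt => /orP[/eqP eqr|ltr] nl.
    rewrite bE /G -eqr leqnn; apply: lead0_free => // l0; apply: nl.
    by exists p.1; rewrite mle_refl eqr -surjective_pairing; split.
  rewrite bE /G leqNgt ltr /=; case: excluded_middle_informative => // h.
  case: h => -[i [tau k]] [/= eqp l]; case: nl; rewrite eqp.
  exact: lead_mle (mle_mshift _ _) l.
move=> ltr /(lead_unshift ltr) h; rewrite bE /G leqNgt ltr /=.
case: excluded_middle_informative => // h'.
case: constructive_indefinite_description => -[i q] [/= eqp l].
have lt : ilt q p by rewrite eqp; apply: ilt_mshift.
by exists i, q; split=> //; rewrite lt.
Qed.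

Lemma prolongation : exists D : 'I_m -> U -> U,
  commuting_derivations D /\ forall i c, D i (j c) = delta i c.
Proof.
have [der [b [derP b_low b_free b_lead]]] := prolongation_values.
pose D := der b.
have Dder i : is_derivation (D i) by case: (derP b i).
have Dj i c : D i (j c) = delta i c by case: (derP b i).
have Dx i p : D i (x p) = free_value b i p by case: (derP b i).
have DK i c : D i (j (kappa c)) = j (kappa (d i c)) by rewrite Dj delta_const.
have b_lt p : (msum p.1 < r)%N -> b p = j (a p).
  by move=> lt; rewrite b_low ?b0_lt // ltnW.
have ilt_low p q : (msum q.1 <= r)%N -> ilt p q -> b p = b0 p.
  by move=> le /iltW/ile_msum le'; apply: b_low; apply: leq_trans le.
have determined_lead0 p : (msum p.1 <= r)%N -> lead0 p -> determined b p.
  move=> le l0 Delta der_Delta DeltaK Deltab; rewrite b_low //.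
  by apply: (lead0_determined le l0) => // q lt; rewrite -(ilt_low _ _ le lt) Deltab.
(* Well-founded induction on the target: every way of reaching [p] by one shift must give the same
   value. *)
have main p : forall i q, p = ishift q i -> D i (b q) = b p.
  elim/(well_founded_ind (@ilt_wf m n)): p => p IH.
  have IHs q i : ilt (ishift q i) p -> D i (b q) = b (ishift q i).
    by move=> lt; apply: IH lt _ _ erefl.
  (* Determinedness climbs from [rho] to [q] one shift at a time; all shifts involved end below [p],
     where the induction hypothesis applies. *)
  have determined_lead q : ilt q p -> lead q -> determined b q.
    case: q => sigma k lt [rho [/= le lem l0]]; move: lt.
    apply: (mle_ind (P := fun s => ilt (s, k) p -> determined b (s, k))) le.
      by move=> _; apply: determined_lead0.
    move=> tau i _ IHtau lt; have ltt := ilt_trans (ilt_mshift (tau, k) i) lt.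
    apply: (determined_ishift (D := D i) (i := i) (p := (tau, k))) => //; last exact: IHtau.
    move=> q /(ile_eqVlt m_gt0)[->|ltq]; first exact: IHs.
    by apply: IHs; apply: ilt_trans lt; apply: (ilt_mshift2 i ltq).
  (* Below [t], a value at a non-leader lies in [F] or is a variable, and a value at a leader is
     determined by smaller ones; so [Delta] kills them all in turn. *)
  have vanish Delta t : is_derivation Delta -> (forall c, Delta (j c) = 0) ->
      ilt t p -> lead t ->
      (forall q, ilt q t -> (r <= msum q.1)%N -> ~ lead q -> Delta (x q) = 0) ->
      Delta (b t) = 0.
    move=> der_Delta Deltaj ltt lt Deltax.
    apply: (determined_lead t ltt lt Delta der_Delta) => [c|q]; first exact: Deltaj.
    elim/(well_founded_ind (@ilt_wf m n)): q => q IHq ltq.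
    have [lq|nlq] := classic (lead q).
      apply: (determined_lead q (ilt_trans ltq ltt) lq Delta der_Delta) => [c|q' lt'].
        exact: Deltaj.
      by apply: IHq => //; apply: ilt_trans ltq.
    have [ltr|ler] := ltnP (msum q.1) r; first by rewrite b_lt.
    by rewrite b_free // Deltax.
  move=> i q eqp.
  have ltqp : ilt q p by rewrite eqp; apply: ilt_mshift.
  have [ltr|ler] := ltnP (msum q.1) r.
    by rewrite b_lt // Dj delta_gen // -eqp b_low // eqp /= msum_mshift.
  have ltrp : (r < msum p.1)%N by rewrite eqp /= msum_mshift.
  have [lq|nlq] := classic (lead q); last first.
    by rewrite b_free // Dx /free_value ler /= -eqp; case: leadP.
  have lp : lead p.
    by move: lq; rewrite eqp; case: (q) => s k; apply: lead_mle; apply: mle_mshift.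
  have [i0 [q0 [eqp0 lq0 bpE]]] := b_lead p ltrp lp.
  have ltq0p : ilt q0 p by rewrite eqp0; apply: ilt_mshift.
  (* The truncated and final derivations agree on [F], and on [x q'] for [q'] below [q0], since then
     [ishift q' i0] lies below [p]; their difference therefore kills [b q0]. *)
  have -> : b p = D i0 (b q0).
    rewrite bpE; apply/eqP; rewrite -subr_eq0; apply/eqP.
    set b' := fun _ => _; have [der' j' x'] := derP b' i0.
    apply: (vanish (fun y => der b' i0 y - D i0 y) q0) => //.
    - exact: derivation_sub.
    - by move=> c; rewrite j' Dj subrr.
    move=> q' lt' _ _; rewrite x' Dx /free_value /b' eqp0.
    by rewrite (ilt_mshift2 i0 lt') subrr.
  (* Diamond argument: for distinct directions, the common predecessor [t] of [q1] and [q2] is still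
     above [rho], hence a leader, and the commutator of [D i1] and [D i2] kills its value. *)
  have link i1 i2 q1 q2 rho : p = ishift q1 i1 -> p = ishift q2 i2 ->
      mle rho q1.1 -> mle rho q2.1 -> lead (rho, p.2) -> D i1 (b q1) = D i2 (b q2).
    case: q1 q2 => [s1 k1] [s2 k2] /= eq1 eq2 le1 le2.
    have lt1 : ilt (s1, k1) p by rewrite eq1; apply: ilt_mshift.
    have lt2 : ilt (s2, k2) p by rewrite eq2; apply: ilt_mshift.
    move: (eq2); rewrite {1}eq1 => -[eqs k12]; subst k1; rewrite eq2 /= => lrho.
    have [e12|ne12] := eqVneq i1 i2; first by move: eqs; rewrite e12 => /mshift_inj ->.
    have lti : (rho i2 < s1 i2)%N.
      have := congr1 (fun s : MI m => s i2) eqs; rewrite /= !mshiftE eqxx.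
      rewrite eq_sym (negbTE ne12) addn0 addn1 => ->; rewrite ltnS.
      by move/mleP: le2.
    have [t s1E let_] := mle_unshift le1 lti.
    have s2E : s2 = mshift t i1.
      by apply: (@mshift_inj m i2); rewrite -eqs s1E mshiftC.
    have lett : lead (t, k2) by apply: lead_mle let_ lrho.
    rewrite s1E s2E in lt1 lt2 *.
    rewrite -(IHs (t, k2) i2) // -(IHs (t, k2) i1) //.
    have ltt : ilt (t, k2) p by apply: ilt_trans lt2; apply: (ilt_mshift (t, k2)).
    apply/eqP; rewrite -subr_eq0; apply/eqP.
    apply: (determined_lead _ ltt lett (fun y => D i1 (D i2 y) - D i2 (D i1 y))).
    - exact: derivation_commutator.
    - by move=> c; rewrite !DK d_comm subrr.
    move=> q' lt'.
    have lt1' := ilt_mshift2 i1 lt'; have lt2' := ilt_mshift2 i2 lt'.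
    have f1 : ilt (ishift q' i1) p by apply: ilt_trans lt1' lt2.
    have f2 : ilt (ishift q' i2) p by apply: ilt_trans lt2' lt1.
    have f12 : ilt (ishift (ishift q' i1) i2) p.
      by rewrite eq2 s2E; apply: (ilt_mshift2 i2 lt1').
    have f21 : ilt (ishift (ishift q' i2) i1) p.
      by rewrite eq1 s1E; apply: (ilt_mshift2 i1 lt2').
    by rewrite (IHs _ _ f1) (IHs _ _ f2) (IHs _ _ f12) (IHs _ _ f21) /ishift /= mshiftC subrr.
  have [rho [le lemu lr]] := lead_below_mu lq.
  have [rho0 [le0 lemu0 lr0]] := lead_below_mu lq0.
  have kq : q.2 = p.2 by rewrite eqp.
  have kq0 : q0.2 = p.2 by rewrite eqp0.
  (* As [sup] is below both [mu] and [p], there is an index [t] just below [p] and above [sup]; it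
     is linked to [q] through [rho] and to [q0] through [rho0]. *)
  pose sup : MI m := [ffun l => maxn (rho l) (rho0 l)].
  have le_sup : mle rho sup by apply/mleP => l; rewrite ffunE leq_maxl.
  have le_sup0 : mle rho0 sup by apply/mleP => l; rewrite ffunE leq_maxr.
  have sup_mu : mle sup mu.
    by apply/mleP => l; rewrite ffunE geq_max; move/mleP: lemu => ->; move/mleP: lemu0 => ->.
  have sup_p : mle sup p.1.
    have /mleP h : mle rho p.1 by rewrite eqp; apply: mle_trans le (mle_mshift _ _).
    have /mleP h0 : mle rho0 p.1 by rewrite eqp0; apply: mle_trans le0 (mle_mshift _ _).
    by apply/mleP => l; rewrite ffunE geq_max h h0.
  have [|l ltl] := mle_lt_exists sup_p.
    by apply: leq_ltn_trans ltrp; rewrite -msum_mu; apply: mle_msum.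
  have [t pE le_t] := mle_unshift sup_p ltl.
  have pE' : p = ishift (t, p.2) l by rewrite /ishift -pE -surjective_pairing.
  have -> : D i (b q) = D l (b (t, p.2)).
    by apply: (link _ _ _ _ rho) => //; [exact: mle_trans le_sup le_t|rewrite -kq].
  apply: (link l i0 (t, p.2) q0 rho0) => //; last by rewrite -kq0.
  exact: mle_trans le_sup0 le_t.
have Dshift p i : D i (b p) = b (ishift p i) by apply: main.
exists D; split=> //; split=> // i l y.
have D0 i' : D i' 0 = 0 by apply: derivation0.
apply/eqP; rewrite -subr_eq0; apply/eqP.
pose comm_der := derivation_commutator (Dder i) (Dder l).
apply: (generated (derivation_kernel_subfield (idfun : {rmorphism U -> U}) comm_der)).
- by move=> c /=; rewrite !DK d_comm subrr.
- by move=> p ltp /=; rewrite -b_lt // !Dshift /ishift /= mshiftC subrr.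
(* A variable is either a value [b p], on which both orders give the double shift, or has all
   derivatives 0. *)
move=> p /=; have [/andP[ler nl]|nfree] := boolP ((r <= msum p.1)%N && ~~ leadb p).
  by rewrite -b_free //; [rewrite !Dshift /ishift /= mshiftC subrr|apply/leadP].
by rewrite !Dx /free_value (negbTE nfree) !D0 subrr.
Qed.

End Prolongation.

(** * The generic linear lift of level r *)

Section MapDerivation.
Variables (K : fieldType) (N : nat) (d : K -> K).
Hypothesis d_der : is_derivation d.

Lemma mcoeff_map_derivation (f : mpoly N K) k : (map_mpoly d f)@_k = d f@_k.
Proof.
pose m1 := GRing.isZmodMorphism.Build K K d (derivB (is_derivation_along d_der)).
exact: (mcoeff_map_mpoly (HB.pack d m1 : {additive K -> K})).
Qed.

Lemma map_mpolyD_derivation (f g : mpoly N K) :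
  map_mpoly d (f + g) = map_mpoly d f + map_mpoly d g.
Proof.
by apply/mpolyP => k; rewrite mcoeffD !mcoeff_map_derivation mcoeffD d_der.1.
Qed.

Lemma map_mpolyM_derivation (f g : mpoly N K) :
  map_mpoly d (f * g) = f * map_mpoly d g + map_mpoly d f * g.
Proof.
apply/mpolyP => k; have lt : (mdeg k < (mdeg k).+1)%N by [].
rewrite mcoeffD mcoeff_map_derivation !(mcoeff_poly_mul _ _ lt).
rewrite (deriv_sum (is_derivation_along d_der)) -big_split /=.
by apply: eq_bigr => l _; rewrite d_der.2 !mcoeff_map_derivation.
Qed.

Lemma map_mpolyC_derivation c : map_mpoly d (c%:MP_[N]) = (d c)%:MP_[N].
Proof.
apply/mpolyP => k; rewrite mcoeff_map_derivation !mcoeffC.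
by case: eqP => _; rewrite ?mulr1 // !mulr0 derivation0.
Qed.

Lemma map_mpolyX_derivation (l : 'I_N) : map_mpoly d ('X_l : mpoly N K) = 0.
Proof.
apply/mpolyP => k; rewrite mcoeff_map_derivation mcoeffX mcoeff0.
by case: eqP => _; rewrite ?derivation1 // derivation0.
Qed.

End MapDerivation.

Lemma map_mpoly_horner (K F L : comNzRingType) (kappa : {rmorphism K -> F})
    (j : {rmorphism F -> L}) (iota : {rmorphism K -> L}) N (f : mpoly N K)
    (v : 'I_N -> F) (w : 'I_N -> L) :
  (forall c, iota c = j (kappa c)) -> (forall l, w l = j (v l)) ->
  (map_mpoly iota f).@[w] = j ((map_mpoly kappa f).@[v]).
Proof.
move=> iotaE wE; elim/mpolyind: f => [|c m p _ _ IH]; first by rewrite !raddf0.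
rewrite !raddfD /= !map_mpolyZ !mevalZ IH rmorphM -iotaE.
congr (_ * _ + _); rewrite !map_mpolyX !mevalX rmorph_prod.
by apply: eq_bigr => l _; rewrite wE rmorphXn.
Qed.

Lemma derivation_horner (U : fieldType) (D : U -> U) (p : {poly U}) z :
  is_derivation D -> (forall k, D p`_k = 0) -> D p.[z] = p^`().[z] * D z.
Proof.
move=> D_der; elim/poly_ind: p => [_|p c IH Dcoef].
  by rewrite poly.deriv0 !horner0 mul0r derivation0.
have Dc : D c = 0 by have := Dcoef 0%N; rewrite coefD coefMX coefC add0r.
have Dp k : D p`_k = 0 by have := Dcoef k.+1; rewrite coefD coefMX coefC addr0.
by rewrite derivMXaddC !hornerE D_der.1 D_der.2 Dc (IH Dp); ring.
Qed.

Lemma map_poly_preimage (F L : fieldType) (j : {rmorphism F -> L}) (p : {poly L}) :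
  (forall k, exists y, p`_k = j y) -> exists q, p = map_poly j q.
Proof.
elim/poly_ind: p => [_|p c IH coef]; first by exists 0; rewrite rmorph0.
have [|q ->] := IH.
  by move=> k; have [y] := coef k.+1; rewrite coefD coefMX coefC addr0; exists y.
have [y] := coef 0%N; rewrite coefD coefMX coefC add0r /= => ->.
by exists (q * 'X + y%:P); rewrite rmorphD rmorphM /= map_polyX map_polyC.
Qed.

(* Greedy choice along the sequence [A]: an element that is not an [F]-linear
   combination of [1] and its predecessors is sent to the corresponding entry of [X]. *)
Lemma generic_linear_lift (F L U : fieldType) (jL : {rmorphism F -> L})
    (jU : {rmorphism F -> U}) (A : nat -> L) (X : nat -> U) N :
  exists B : nat -> U,
    (forall c0 (c : nat -> F), jL c0 + \sum_(k < N) jL (c k) * A k = 0 ->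
       jU c0 + \sum_(k < N) jU (c k) * B k = 0) /\
    (forall k, (k < N)%N ->
       (exists c0 (c : nat -> F), A k = jL c0 + \sum_(l < k) jL (c l) * A l /\
          B k = jU c0 + \sum_(l < k) jU (c l) * B l) \/ B k = X k).
Proof.
elim: N => [|N [B [Brel Bval]]].
  exists X; split=> // c0 c; rewrite !big_ord0 !addr0 => /eqP.
  by rewrite fmorph_eq0 => /eqP ->; rewrite rmorph0.
pose ext z k := if k == N then z else B k.
have ext_lt z k : (k < N)%N -> ext z k = B k.
  by move=> lt; rewrite /ext ltn_eqF.
have ext_sum z (c : nat -> F) k : (k <= N)%N ->
    \sum_(l < k) jU (c l) * ext z l = \sum_(l < k) jU (c l) * B l.
  by move=> le; apply: eq_bigr => l _; rewrite ext_lt // (leq_trans (ltn_ord l)).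
have extN z : ext z N = z by rewrite /ext eqxx.
have Bval' z k : (k < N)%N ->
    (exists c0 (c : nat -> F), A k = jL c0 + \sum_(l < k) jL (c l) * A l /\
       ext z k = jU c0 + \sum_(l < k) jU (c l) * ext z l) \/ ext z k = X k.
  move=> lt; rewrite ext_lt //; have [[c0 [c [Ak Bk]]]|] := Bval k lt; last by right.
  by left; exists c0, c; rewrite ext_sum // ltnW.
have [[c0' [c' AN]]|nA] :=
  classic (exists c0 (c : nat -> F), A N = jL c0 + \sum_(l < N) jL (c l) * A l).
  pose z := jU c0' + \sum_(l < N) jU (c' l) * B l.
  exists (ext z); split=> [c0 c|k].
    rewrite !big_ord_recr /= ext_sum // extN AN /z => rel.
    (* Substituting the expression for [A N] turns the relation into one of length [N] with these
       coefficients. *)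
    have := Brel (c0 + c N * c0') (fun l => c l + c N * c' l).
    have dist (V : fieldType) (j : {rmorphism F -> V}) (C : nat -> V) :
        j (c0 + c N * c0') + \sum_(l < N) j (c l + c N * c' l) * C l =
        j c0 + (\sum_(l < N) j (c l) * C l +
                j (c N) * (j c0' + \sum_(l < N) j (c' l) * C l)).
      rewrite (eq_bigr (fun l : 'I_N => j (c l) * C l + j (c N) * (j (c' l) * C l))).
        by rewrite big_split /= -mulr_sumr rmorphD rmorphM; ring.
      by move=> l _; rewrite rmorphD rmorphM mulrDl mulrA.
    by rewrite !dist; apply.
  rewrite ltnS leq_eqVlt => /orP[/eqP ->|]; last exact: Bval'.
  by left; exists c0', c'; rewrite extN ext_sum.
exists (ext (X N)); split=> [c0 c|k]; last first.
  rewrite ltnS leq_eqVlt => /orP[/eqP ->|]; last exact: Bval'.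
  by right; rewrite extN.
rewrite !big_ord_recr /= ext_sum // extN => rel.
(* Otherwise the relation could be solved for [A N], against [nA]. *)
have cN0 : c N = 0.
  apply/eqP/negPn/negP => cN; apply: nA.
  exists (- c0 / c N), (fun l => - c l / c N).
  have jcN : jL (c N) != 0 by rewrite fmorph_eq0.
  have cdiv y : c N * (- y / c N) = - y by rewrite mulrC divfK.
  apply: (mulfI jcN); rewrite mulrDr mulr_sumr.
  have -> : \sum_(l < N) jL (c N) * (jL (- c l / c N) * A l) =
            - \sum_(l < N) jL (c l) * A l.
    rewrite -sumrN; apply: eq_bigr => l _.
    by rewrite mulrA -rmorphM cdiv rmorphN mulNr.
  rewrite -rmorphM cdiv rmorphN -opprD; apply/eqP.
  by rewrite -addr_eq0 addrC -addrA rel.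
move: rel; rewrite cN0 !rmorph0 !mul0r !addr0; exact: Brel.
Qed.

Lemma subfield_closed_preimage (F U : fieldType) (j : {rmorphism F -> U}) (S : U -> Prop) :
  subfield_closed S -> subfield_closed (fun y => S (j y)).
Proof.
case=> S1 SB SM SV; split=> [|y z|y z|y]; rewrite ?rmorph1 ?rmorphB ?rmorphM ?fmorphV //.
- exact: SB.
- exact: SM.
- exact: SV.
Qed.

Lemma subfield_closed_image (F U : fieldType) (j : {rmorphism F -> U}) (S : F -> Prop) :
  subfield_closed S -> subfield_closed (fun z => exists2 y, z = j y & S y).
Proof.
case=> S1 SB SM SV; split.
- by exists 1; rewrite ?rmorph1.
- by move=> _ _ [y -> Sy] [z -> Sz]; exists (y - z); rewrite ?rmorphB //; apply: SB.
- by move=> _ _ [y -> Sy] [z -> Sz]; exists (y * z); rewrite ?rmorphM //; apply: SM.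
by move=> _ [y -> Sy]; exists y^-1; rewrite ?fmorphV //; apply: SV.
Qed.

Lemma gen_field_closed (K L : fieldType) (iota : {rmorphism K -> L}) (A : L -> Prop) :
  subfield_closed (gen_field iota A).
Proof.
split=> [S Scl _ _|y z hy hz S Scl Sc SA|y z hy hz S Scl Sc SA|y hy S Scl Sc SA];
  case: (Scl) => S1 SB SM SV //.
- by apply: SB; [apply: hy|apply: hz].
- by apply: SM; [apply: hy|apply: hz].
- by apply: SV; apply: hy.
Qed.

Lemma gen_field_const (K L : fieldType) (iota : K -> L) (A : L -> Prop) c :
  gen_field iota A (iota c).
Proof. by move=> S _ Sc _; apply: Sc. Qed.

Lemma gen_by_gen (K L : fieldType) (iota : K -> L) m n (a : MI m -> 'I_n -> L)
    (P : MI m -> 'I_n -> Prop) xi k : P xi k -> gen_by iota a P (a xi k).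
Proof. by move=> Pxi S _ _ SA; apply: SA; exists xi, k. Qed.

Lemma rmorphism_factor (K F L : fieldType) (iota : {rmorphism K -> L})
    (j : {rmorphism F -> L}) :
  (forall c, exists y, iota c = j y) ->
  exists kappa : {rmorphism K -> F}, forall c, iota c = j (kappa c).
Proof.
move=> im; pose k c := proj1_sig (constructive_indefinite_description _ (im c)).
have kE c : iota c = j (k c) by rewrite /k; case: constructive_indefinite_description.
have j_inj : injective j := fmorph_inj j.
have kB : zmod_morphism k by move=> c c'; apply: j_inj; rewrite rmorphB -!kE rmorphB.
have kM : monoid_morphism k.
  by split=> [|c c']; apply: j_inj; rewrite ?rmorph1 ?rmorphM -!kE ?rmorph1 ?rmorphM.
pose m1 := GRing.isZmodMorphism.Build K F k kB.
pose m2 := GRing.isMonoidMorphism.Build K F k kM.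
by exists (HB.pack k m1 m2 : {rmorphism K -> F}).
Qed.

(** The enumeration is increasing so that predecessors in the greedy choice of [generic_linear_lift]
    are smaller indices. *)
Lemma indices_upto m n r : exists s : seq (MI m * 'I_n),
  [/\ uniq s, sorted (@ile m n) s & forall p, (p \in s) = (msum p.1 <= r)%N].
Proof.
pose all := [seq ([ffun i => val (z.1 i)] : MI m, z.2)
            | z : {ffun 'I_m -> 'I_r.+1} * 'I_n <- enum {: {ffun 'I_m -> 'I_r.+1} * 'I_n}].
exists (sort (@ile m n) (filter (fun p => (msum p.1 <= r)%N) (undup all))); split.
- by rewrite sort_uniq filter_uniq ?undup_uniq.
- by apply: sort_sorted => p q; apply: ile_total.
move=> p; rewrite mem_sort mem_filter mem_undup andb_idr // => le.
have le_i i : (p.1 i < r.+1)%N.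
  by rewrite ltnS (leq_trans _ le) // /msum (bigD1 i) //= leq_addr.
apply/mapP; exists ([ffun i => inord (p.1 i)], p.2); first by rewrite mem_enum.
case: p le le_i => sigma k le le_i; congr (_, _).
by apply/ffunP => i; rewrite !ffunE /= inordK.
Qed.

Lemma mderivXU (K : fieldType) N (k l : 'I_N) : ('X_k : mpoly N K)^`M(l) = (k == l)%:R.
Proof.
rewrite mderivX mnm1E; case: eqVneq => [->|_]; last by rewrite scale0r.
have -> : (U_(l) - U_(l) = 0 :> 'X_{1..N})%MM.
  by apply/mnmP => i; rewrite mnmBE mnm0E subnn.
by rewrite scale1r mpolyX0.
Qed.

(** Merges repeated terms: a relation over an arbitrary family of indices becomes one over positions
    in the enumeration. *)
Lemma collect_sum (F V : fieldType) (j : {rmorphism F -> V}) (A : nat -> V) N M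
    (i : 'I_M -> nat) (c : 'I_M -> F) : (forall l, (i l < N)%N) ->
  \sum_(l < M) j (c l) * A (i l) =
  \sum_(k < N) j (\sum_(l < M) c l *+ (i l == k)) * A k.
Proof.
move=> lti; under [RHS]eq_bigr => k _ do rewrite rmorph_sum mulr_suml.
rewrite exchange_big /=; apply: eq_bigr => l _.
rewrite (bigD1 (Ordinal (lti l))) //= eqxx mulr1n big1 ?addr0 // => k ne.
by rewrite eq_sym (negbTE ne : (k == i l :> nat) = false) rmorph0 mul0r.
Qed.

(** * The base field [F]: the lift of level r, derivations into [U], and leaders *)

Section BaseField.
Variables (m n : nat) (K F L : fieldType) (iota : {rmorphism K -> L}).
Variables (kappa : {rmorphism K -> F}) (jL : {rmorphism F -> L}).
Local Notation idx := (MI m * 'I_n)%type.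
Implicit Types p q : idx.
Variables (a : MI m -> 'I_n -> L) (aF : idx -> F) (r : nat).
Hypothesis iotaE : forall c, iota c = jL (kappa c).
Hypothesis aFE : forall p, (msum p.1 < r)%N -> a p.1 p.2 = jL (aF p).

Lemma gen_by_ind (P : idx -> Prop) (S : F -> Prop) :
  (forall p, P p -> (msum p.1 < r)%N) -> subfield_closed S ->
  (forall c, S (kappa c)) -> (forall p, P p -> S (aF p)) ->
  forall y, gen_by iota a (fun xi k => P (xi, k)) (jL y) -> S y.
Proof.
move=> lowP Scl Sc SP y gen_y.
have [|c|_ [xi [k [Pxi ->]]]|y' /fmorph_inj -> //] :=
  gen_y (fun z => exists2 y, z = jL y & S y).
- exact: subfield_closed_image.
- by exists (kappa c).
by exists (aF (xi, k)); [apply: (aFE (lowP _ Pxi))|apply: SP].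
Qed.

Variables (U : fieldType) (jU : {rmorphism F -> U}) (x : idx -> U).

(** The same coefficients serve in [L] and in [U]: the first equation makes [p] a separable leader,
    the second makes [b p] determined. *)
Definition linear_over_lower (b : idx -> U) p :=
  exists M (w : 'I_M -> idx) c0 (c : 'I_M -> F),
    [/\ forall l, ilt (w l) p,
        a p.1 p.2 = jL c0 + \sum_(l < M) jL (c l) * a (w l).1 (w l).2 &
        b p = jU c0 + \sum_(l < M) jU (c l) * b (w l)].

Lemma linear_lift (p0 : idx) : (0 < m)%N -> exists b : idx -> U,
  [/\ forall M (w : 'I_M -> idx) c0 (c : 'I_M -> F),
        (forall l, msum (w l).1 <= r)%N ->
        jL c0 + \sum_(l < M) jL (c l) * a (w l).1 (w l).2 = 0 ->
        jU c0 + \sum_(l < M) jU (c l) * b (w l) = 0,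
      forall p, (msum p.1 < r)%N -> b p = jU (aF p) &
      forall p, (msum p.1 <= r)%N -> linear_over_lower b p \/ b p = x p].
Proof.
move=> m_gt0; have [s [s_uniq s_sorted mem_s]] := indices_upto m n r.
pose A k := a (nth p0 s k).1 (nth p0 s k).2.
have [B [Brel Bval]] := generic_linear_lift jL jU A (fun k => x (nth p0 s k)) (size s).
have AE p : (msum p.1 <= r)%N -> a p.1 p.2 = A (index p s).
  by move=> le; rewrite /A nth_index ?mem_s.
have rel M (w : 'I_M -> idx) c0 (c : 'I_M -> F) : (forall l, msum (w l).1 <= r)%N ->
    jL c0 + \sum_(l < M) jL (c l) * a (w l).1 (w l).2 = 0 ->
    jU c0 + \sum_(l < M) jU (c l) * B (index (w l) s) = 0.
  move=> le; have lt l : (index (w l) s < size s)%N by rewrite index_mem mem_s.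
  under eq_bigr => l _ do rewrite AE //.
  rewrite !(collect_sum _ _ _ lt).
  exact: (Brel c0 (fun k => \sum_(l < M) c l *+ (index (w l) s == k))).
exists (fun p => B (index p s)); split=> // p.
  (* Below level [r], [- aF p + a p = 0] is itself a linear relation over [F], which forces the
     lifted value. *)
  move=> lt; have := rel 1%N (fun=> p) (- aF p) (fun=> 1) (fun=> ltnW lt).
  rewrite !big_ord1 !rmorph1 !mul1r !rmorphN aFE // addNr => /(_ erefl) /eqP.
  by rewrite addrC subr_eq0 => /eqP.
move=> le; have ps : p \in s by rewrite mem_s.
have lt : (index p s < size s)%N by rewrite index_mem.
have [[c0 [c [Ak Bk]]]|->] := Bval _ lt; last by right; rewrite nth_index.
left; exists (index p s), (fun l => nth p0 s l), c0, (fun l => c l); split.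
- move=> l; have lt_l := ltn_trans (ltn_ord l) lt.
  have le_l : ile (nth p0 s l) p.
    rewrite -{2}(nth_index p0 ps).
    by apply: (sorted_ltn_nth _ p0 s_sorted) => //; move=> q1 q2 q3; apply: lexle_trans.
  have [eqp|//] := ile_eqVlt m_gt0 le_l.
  by have := ltn_ord l; rewrite -{2}eqp index_uniq // ltnn.
- by rewrite AE.
rewrite Bk; congr (_ + _); apply: eq_bigr => l _.
by rewrite index_uniq // (ltn_trans (ltn_ord l)).
Qed.

Variables (d : 'I_m -> K -> K) (mu : MI m).
Hypothesis d_der : forall i, is_derivation (d i).
Hypothesis diff_cond : differential_condition iota d mu a.
Hypothesis r_def : msum mu = r.
Hypothesis F_gen : forall y, gen_by iota a (fun xi _ => (msum xi < r)%N) (jL y).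

Lemma ile_greatest (s : seq idx) q : q \in s ->
  exists2 p, p \in s & forall q', q' \in s -> ile q' p.
Proof.
elim: s q => // p s IH q _; case: s IH => [_|q' s IH].
  by exists p; rewrite ?mem_head // => q'; rewrite inE => /eqP ->; apply: ile_refl.
have [p' p's p'max] := IH q' (mem_head _ _).
case/orP: (ile_total p p') => le.
  exists p'; first by rewrite inE p's orbT.
  by move=> q''; rewrite inE => /orP[/eqP ->|/p'max].
exists p; first exact: mem_head.
move=> q''; rewrite inE => /orP[/eqP ->|/p'max le']; first exact: ile_refl.
exact: lexle_trans le' le.
Qed.

(** The differential condition turns a polynomial relation over K among values of level below [r]
    into an [F]-linear relation up to level [r]; [rel] carries it to [U], so the derivation is well
    defined. *)
Lemma base_derivation (b : idx -> U) (p0 : idx) i : (msum p0.1 < r)%N ->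
  (forall M (w : 'I_M -> idx) c0 (c : 'I_M -> F),
     (forall l, msum (w l).1 <= r)%N ->
     jL c0 + \sum_(l < M) jL (c l) * a (w l).1 (w l).2 = 0 ->
     jU c0 + \sum_(l < M) jU (c l) * b (w l) = 0) ->
  exists delta : F -> U,
    [/\ derivation_along jU delta, forall c, delta (kappa c) = jU (kappa (d i c)) &
        forall p, (msum p.1 < r)%N -> delta (aF p) = b (ishift p i)].
Proof.
move=> p0_low rel; have [s [s_uniq _ mem_s]] := indices_upto m n r.
pose t := [seq p <- s | (msum p.1 < r)%N].
have mem_t p : (p \in t) = (msum p.1 < r)%N.
  by rewrite mem_filter mem_s andb_idr // => /ltnW.
pose v (l : 'I_(size t)) := tnth (in_tuple t) l.
have v_low l : (msum (v l).1 < r)%N by rewrite -mem_t mem_tnth.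
have v_inj : injective v by apply/tuple_uniqP; rewrite filter_uniq.
have v_surj p : (msum p.1 < r)%N -> exists l, p = v l.
  by rewrite -mem_t => /(tnthP (in_tuple t)).
have [e eE] : exists e : {rmorphism mpoly (size t) K -> F},
    forall f, e f = (map_mpoly kappa f).@[fun l => aF (v l)].
  by exists (GRing.RMorphism.clone _ _ (meval (fun l => aF (v l)) \o map_mpoly kappa) _).
(* The chain rule, with the lifted value at the shifted index as derivative of each generator. *)
pose E f := \sum_l jU (e f^`M(l)) * b (ishift (v l) i) + jU (e (map_mpoly (d i) f)).
have eC c : e c%:MP_[size t] = kappa c by rewrite eE map_mpolyC mevalC.
have eX l : e 'X_l = aF (v l) by rewrite eE map_mpolyX mevalXU.
have frac y : exists f g, e g != 0 /\ e f = y * e g.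
  apply: (gen_by_ind (P := fun p => (msum p.1 < r)%N)
                    (S := fun y => exists f g, e g != 0 /\ e f = y * e g)) (F_gen y) => //.
  - split=> [|y1 y2 [f1 [g1 [nz1 e1]]] [f2 [g2 [nz2 e2]]]
             |y1 y2 [f1 [g1 [nz1 e1]]] [f2 [g2 [nz2 e2]]]|y1 [f1 [g1 [nz1 e1]]]].
    + by exists 1, 1; rewrite rmorph1 oner_eq0 mul1r.
    + exists (f1 * g2 - f2 * g1), (g1 * g2).
      by rewrite rmorphB !rmorphM mulf_neq0 //= e1 e2; split=> //; ring.
    + exists (f1 * f2), (g1 * g2).
      by rewrite !rmorphM mulf_neq0 //= e1 e2; split=> //; ring.
    have [y0|ynz] := eqVneq y1 0; first by exists f1, g1; rewrite e1 y0 invr0.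
    by exists g1, f1; rewrite e1 mulf_neq0 // mulKf.
  - by move=> c; exists c%:MP, 1; rewrite rmorph1 oner_eq0 mulr1 eC.
  move=> p /v_surj[l ->]; exists 'X_l, 1.
  by rewrite rmorph1 oner_eq0 mulr1 eX.
have E_der : derivation_along (jU \o e) E.
  split=> f g; rewrite /E.
    rewrite map_mpolyD_derivation // !rmorphD addrACA -big_split /=; congr (_ + _).
    by apply: eq_bigr => l _; rewrite mderivD !rmorphD mulrDl.
  rewrite map_mpolyM_derivation // rmorphD !rmorphM.
  rewrite (eq_bigr (fun l => (jU \o e) f * (jU (e g^`M(l)) * b (ishift (v l) i)) +
      (jU (e f^`M(l)) * b (ishift (v l) i)) * (jU \o e) g)); last first.
    by move=> l _; rewrite mderivM rmorphD !rmorphM rmorphD !rmorphM /=; ring.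
  by rewrite big_split /= -mulr_sumr -mulr_suml; ring.
have E_ker f : e f = 0 -> E f = 0.
  move=> ef0; rewrite /E addrC.
  apply: (rel _ (fun l => ishift (v l) i)).
    by move=> l; rewrite /= msum_mshift.
  (* The differential condition wants all variables below a single index, so the greatest index of
     level below [r] is taken; [p0] ensures that one exists. *)
  have [|[sigma k] qt qmax] := @ile_greatest t p0; first by rewrite mem_t.
  have low : (msum sigma + 1 <= msum mu)%N.
    by rewrite r_def addn1; rewrite mem_t in qt.
  have hornerE' g : (map_mpoly iota g).@[fun l => a (v l).1 (v l).2] = jL (e g).
    by rewrite eE; apply: map_mpoly_horner => // l; apply: aFE.
  have := @diff_cond i k sigma low (size t) v f v_inj.
  rewrite hornerE' ef0 rmorph0 addrC hornerE' => h.
  under eq_bigr => l _ do rewrite -hornerE'.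
  by apply: h => // l; apply: (qmax (v l)); rewrite mem_t.
have [delta [delta_der deltaE]] := fraction_derivation frac E_der E_ker.
exists delta; split=> // [c|p /v_surj[k ->]].
  rewrite -eC deltaE /E map_mpolyC_derivation // eC big1 ?add0r // => l _.
  by rewrite mderivC !rmorph0 mul0r.
rewrite -eX deltaE /E map_mpolyX_derivation // !rmorph0 addr0.
rewrite (bigD1 k) //= mderivXU eqxx !rmorph1 mul1r big1 ?addr0 // => l ne.
by rewrite mderivXU eq_sym (negbTE ne) !rmorph0 mul0r.
Qed.

(** [Delta] kills the coefficients of the separable polynomial, so differentiating it at its root
    leaves its derivative there, which is nonzero, times [Delta (b p)]. *)
Lemma leader_determined (b : idx -> U) p :
  (forall q, (msum q.1 < r)%N -> b q = jU (aF q)) -> (msum p.1 < r)%N ->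
  separable_leader iota a p.1 p.2 -> determined kappa jU b p.
Proof.
move=> b_low low [f [_ fcoef fsep froot]] Delta Delta_der DeltaK Deltab.
have lower q : ilt q p -> (msum q.1 < r)%N by move=> /iltW/ile_msum le; apply: leq_ltn_trans le low.
have kernel y : gen_by iota a (fun xi k => ilt (xi, k) p) (jL y) -> Delta (jU y) = 0.
  apply: (gen_by_ind (P := fun q => ilt q p) (S := fun y => Delta (jU y) = 0)) => //.
  - exact: derivation_kernel_subfield.
  - by move=> q ltq; rewrite -b_low ?Deltab ?lower.
have [|g fE] := @map_poly_preimage F L jL f.
  move=> k; have [|c|_ [xi [k' [lt ->]]]|y fk _] :=
    fcoef k (fun z => exists2 y, z = jL y & True).
  - by apply: subfield_closed_image; split.
  - by exists (kappa c).
  - by exists (aF (xi, k')); [apply: (aFE (lower (xi, k') lt))|].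
  by exists y.
have groot : root g (aF p) by move: froot; rewrite fE aFE // fmorph_root.
have gsep : separable_poly g by move: fsep; rewrite fE separable_map.
have := derivation_horner (p := map_poly jU g) (jU (aF p)) Delta_der.
rewrite horner_map (rootP groot) rmorph0 derivation0 // => eq0.
have {}eq0 : (map_poly jU g)^`().[jU (aF p)] * Delta (jU (aF p)) = 0.
  rewrite -eq0 // => k; rewrite coef_map /=; apply: kernel.
  by have := fcoef k; rewrite fE coef_map.
move/eqP: eq0; rewrite b_low // mulf_eq0 deriv_map horner_map fmorph_eq0.
by rewrite unlock in gsep; rewrite (negbTE (coprimep_root gsep groot)) => /eqP.
Qed.

Lemma base_kernel (Delta : U -> U) : is_derivation Delta ->
  (forall c, Delta (jU (kappa c)) = 0) ->
  (forall p, (msum p.1 < r)%N -> Delta (jU (aF p)) = 0) -> forall y, Delta (jU y) = 0.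
Proof.
move=> Delta_der DeltaK Deltaa y.
apply: (gen_by_ind (P := fun p => (msum p.1 < r)%N) (S := fun y => Delta (jU y) = 0)) (F_gen y) => //.
exact: derivation_kernel_subfield.
Qed.

(** At level [r] all generators of [F] precede [p], so [Delta] kills [F] and with it every linear
    expression in smaller values. *)
Lemma linear_determined (b : idx -> U) p :
  (forall q, (msum q.1 < r)%N -> b q = jU (aF q)) -> msum p.1 = r ->
  linear_over_lower b p -> determined kappa jU b p.
Proof.
move=> b_low top [M [w [c0 [c [w_lt _ bE]]]]] Delta Delta_der DeltaK Deltab.
have Delta0 y : Delta (jU y) = 0.
  apply: base_kernel => // q low; rewrite -b_low // Deltab //.
  by apply: ilt_msum; rewrite top.
rewrite bE Delta_der.1 (deriv_sum (is_derivation_along Delta_der)) Delta0 add0r.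
by rewrite big1 // => l _; rewrite Delta_der.2 Delta0 Deltab ?w_lt // mulr0 mul0r addr0.
Qed.

(** All of [F] lies in the field of predecessors, hence so does [a p], and ['X - a p] is the
    required polynomial. This brings linear leaders under the hypothesis on minimal separable
    leaders. *)
Lemma linear_separable_leader (b : idx -> U) p : msum p.1 = r ->
  linear_over_lower b p -> separable_leader iota a p.1 p.2.
Proof.
move=> top [M [w [c0 [c [w_lt aE _]]]]].
pose E := gen_by iota a (fun xi h => olt xi h p.1 p.2).
have Ecl : subfield_closed E by apply: gen_field_closed.
have [E1 EB EM EV] := Ecl.
have EF y : E (jL y).
  move=> S Scl Sc SA; apply: (F_gen y) => // _ [xi [k [low ->]]].
  by apply: SA; exists xi, k; split=> //; apply: (@ilt_msum m n (xi, k) p); rewrite top.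
have Ea : E (a p.1 p.2).
  rewrite aE; apply: (subfield_closedD Ecl (EF c0)).
  apply: (subfield_closed_sum _ Ecl) => l _.
  by apply: EM => //; apply: gen_by_gen; apply: w_lt.
exists ('X - (a p.1 p.2)%:P); split.
- by rewrite polyXsubC_eq0.
- move=> k; rewrite coefB coefX coefC; apply: EB.
    by case: (k == _); [exact: E1|apply: subfield_closed0].
  by case: (k == _); [exact: Ea|apply: subfield_closed0].
- by rewrite unlock derivXsubC coprimep1.
by rewrite root_XsubC.
Qed.

End BaseField.

(** * Assembly *)

Lemma subfield_embedding (K L : fieldType) (iota : {rmorphism K -> L}) m n
    (a : MI m -> 'I_n -> L) (r : nat) :
  exists (F : fieldType) (jL : {rmorphism F -> L}) (kappa : {rmorphism K -> F})
    (aF : MI m * 'I_n -> F),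
    [/\ forall y, gen_by iota a (fun xi _ => (msum xi < r)%N) (jL y),
        forall z, gen_by iota a (fun xi _ => (msum xi < r)%N) z -> exists y, z = jL y,
        forall c, iota c = jL (kappa c) &
        forall p, (msum p.1 < r)%N -> a p.1 p.2 = jL (aF p)].
Proof.
pose P (xi : MI m) (_ : 'I_n) : Prop := (msum xi < r)%N.
have [F [jL jLP]] := subfield_exists
  (gen_field_closed iota (fun y => exists xi h, P xi h /\ y = a xi h)).
have [|kappa kappaE] := @rmorphism_factor K F L iota jL.
  by move=> c; apply/jLP; apply: gen_field_const.
have ex p : exists y, (msum p.1 < r)%N -> a p.1 p.2 = jL y.
  have [low|_] := boolP (msum p.1 < r)%N; last by exists 0.
  have [|y ->] := (jLP (a p.1 p.2)).1; first exact: gen_by_gen.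
  by exists y.
exists F, jL, kappa,
  (fun p => proj1_sig (constructive_indefinite_description _ (ex p))); split=> //.
- by move=> y; apply/jLP; exists y.
- by move=> z /jLP.
by move=> p; case: constructive_indefinite_description.
Qed.

(** The theorem asks for a map on all of [L] that embeds only [F]; outside the image of [jL] the
    value 0 is taken. *)
Lemma partial_embedding (F L U : fieldType) (jL : {rmorphism F -> L})
    (jU : {rmorphism F -> U}) : exists phi : L -> U, forall y, phi (jL y) = jU y.
Proof.
have ex z : exists u, forall y, z = jL y -> u = jU y.
  have [[y0 ->]|ny] := classic (exists y, z = jL y).
    by exists (jU y0) => y /fmorph_inj ->.
  by exists 0 => y zy; case: ny; exists y.
exists (fun z => proj1_sig (constructive_indefinite_description _ (ex z))) => y.
by case: constructive_indefinite_description => u /= /(_ y erefl).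
Qed.

Unset Implicit Arguments.

Theorem theorem4p7 (m : nat) (K : fieldType) (d : 'I_m -> K -> K)
  (mu : MI m) (n : nat) (L : fieldType) (iota : {rmorphism K -> L})
  (a : MI m -> 'I_n -> L) :
  (0 < m)%N -> commuting_derivations d -> (0 < n)%N ->
  (* L = K(a_h^xi : |xi| <= |mu|, h < n) *)
  (forall x : L, gen_by iota a (fun xi _ => (msum xi <= msum mu)%N) x) ->
  differential_condition iota d mu a ->
  (forall (sigma : MI m) (k : 'I_n), (msum sigma <= msum mu)%N ->
     minimal_separable_leader iota a sigma k -> mle sigma mu) ->
  exists (M : fieldType) (D : 'I_m -> M -> M) (kappa : {rmorphism K -> M}) (phi : L -> M),
    [/\ commuting_derivations D,
        (forall (i : 'I_m) (c : K), D i (kappa c) = kappa (d i c)),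
        (* phi embeds F := K(a_h^xi : |xi| < |mu|, h < n) into M over K *)
        (let F := gen_by iota a (fun xi _ => (msum xi < msum mu)%N) in
         [/\ forall x y, F x -> F y -> phi (x + y) = phi x + phi y,
             forall x y, F x -> F y -> phi (x * y) = phi x * phi y,
             phi 1 = 1
           & forall c : K, phi (iota c) = kappa c])
      & forall (i : 'I_m) (k : 'I_n) (sigma : MI m), (msum sigma + 1 < msum mu)%N ->
          D i (phi (a sigma k)) = phi (a (mshift sigma i) k)].
Proof.
move=> m_gt0 [d_der d_comm] n_gt0 _ diff_cond min_leader.
have [F [jL [kappa [aF [F_gen F_im iotaE aFE]]]]] :=
  subfield_embedding iota a (msum mu).
suff [U [jU [D [D_comm DK Da]]]] : exists (U : fieldType) (jU : {rmorphism F -> U})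
    (D : 'I_m -> U -> U), [/\ commuting_derivations D,
      forall i c, D i (jU (kappa c)) = jU (kappa (d i c)) &
      forall i p, ((msum p.1).+1 < msum mu)%N -> D i (jU (aF p)) = jU (aF (ishift p i))].
  have [phi phiE] := partial_embedding jL jU.
  exists U, D, (GRing.RMorphism.clone _ _ (jU \o kappa) _), phi; split=> //=.
    split=> [_ _ /F_im[x ->] /F_im[y ->]|_ _ /F_im[x ->] /F_im[y ->]||c].
    - by rewrite -rmorphD !phiE rmorphD.
    - by rewrite -rmorphM !phiE rmorphM.
    - by rewrite -(rmorph1 jL) phiE rmorph1.
    by rewrite iotaE phiE.
  move=> i k sigma; rewrite addn1 => lt.
  rewrite (aFE (sigma, k)) ?(aFE (ishift (sigma, k) i)) /= ?msum_mshift ?(ltnW lt) //.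
  by rewrite !phiE Da.
(* If [mu] has level 0, no generator lies below it, [F] is K, and K itself is the extension.
   Otherwise the zero index has level below that of [mu] and can serve as [p0]. *)
have [mu0|mu_gt0] := posnP (msum mu).
  have F_K y : exists c, y = kappa c.
    have [|c|z [xi [k [low _]]]|c yc _] := F_gen y (fun z => exists2 c, z = iota c & True).
    - by apply: subfield_closed_image; split.
    - by exists c.
    - by move: low; rewrite mu0.
    by exists c; apply: (fmorph_inj jL); rewrite yc iotaE.
  have [psi psiE] := @rmorphism_factor F K F idfun kappa F_K.
  exists K, psi, d; split=> // [i c|i p]; last by rewrite mu0.
  have psi_kappa c' : psi (kappa c') = c' by apply: (fmorph_inj kappa); rewrite -psiE.
  by rewrite !psi_kappa.
have [U [jU [x [U_gen U_ext]]]] := purely_transcendental_extension F (MI m * 'I_n)%type.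
pose p0 : MI m * 'I_n := ([ffun => 0%N], Ordinal n_gt0).
have p0_low : (msum p0.1 < msum mu)%N.
  by rewrite /msum big1 // => l _; rewrite ffunE.
have [b [b_rel b_low b_top]] := linear_lift aFE jU x p0 m_gt0.
have delta_ex i := base_derivation iotaE aFE d_der diff_cond erefl F_gen i p0_low b_rel.
pose delta i := proj1_sig (constructive_indefinite_description _ (delta_ex i)).
have deltaP i : [/\ derivation_along jU (delta i),
    forall c, delta i (kappa c) = jU (kappa (d i c)) &
    forall p, (msum p.1 < msum mu)%N -> delta i (aF p) = b (ishift p i)].
  by rewrite /delta; case: constructive_indefinite_description.
(* At the top level linearity replaces separable algebraicity, because the lift [b] retains only
   linear relations there. *)
pose leader (p : MI m * 'I_n) := if (msum p.1 < msum mu)%N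
  then separable_leader iota a p.1 p.2 else linear_over_lower jL a jU b p.
have leader_separable p : (msum p.1 <= msum mu)%N -> leader p ->
    separable_leader iota a p.1 p.2.
  rewrite /leader leq_eqVlt; case: ltnP => // ge; rewrite orbF => /eqP top.
  exact: linear_separable_leader.
have [] := @prolongation m n K F U kappa jU d x (msum mu) mu m_gt0 d_comm U_ext
  aF b delta leader _ erefl b_low.
- move=> S Scl SK Sa Sx; apply: U_gen => // c.
  apply: (gen_by_ind iotaE aFE (P := fun p => (msum p.1 < msum mu)%N) (S := fun y => S (jU y))) (F_gen c) => //.
  exact: subfield_closed_preimage.
- by move=> i; case: (deltaP i).
- by move=> i; case: (deltaP i).
- by move=> i; case: (deltaP i).
- move=> p; rewrite /leader leq_eqVlt; case: ltnP => [low _|_].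
    exact: (leader_determined iotaE aFE b_low low).
  rewrite orbF => /eqP top.
  exact: (linear_determined iotaE aFE F_gen b_low top).
- move=> p top; rewrite /leader top ltnn => nl.
  by case: (b_top p) => //; rewrite top.
(* An index strictly below [p] has level below that of [mu], where [leader] coincides with separable
   leader; so [p] is a minimal separable leader. *)
- move=> p le lp nlow; apply: (min_leader _ p.2 le); split; first exact: leader_separable.
  move=> rho le_rho ne sep; apply: (nlow rho) => //.
  by rewrite /leader /= (leq_trans (mle_msum_lt le_rho ne) le).
move=> D [D_comm Dj]; exists U, jU, D; split=> // [i c|i p lt].
  by have [_ h _] := deltaP i; rewrite Dj h.
have [_ _ h] := deltaP i.
by rewrite Dj h ?(ltnW lt) // b_low //= msum_mshift.
Qed.
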